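(* Let $p$ be a prime, let $V$ be a finite-dimensional vector space over $\mathbb{Q}_p$ and let $N$ be a norm on $V$ such that $N(v)$ can be computed efficiently for any $v\in V$. Then the problem of finding an $N$-orthogonal basis of a given $p$-adic lattice in $V$ and the Closest Vector Problem in $p$-adic lattices in $V$ are polynomially equivalent, i.e. each can be solved in polynomial time given an oracle for the other.
   Context: A norm on a $\mathbb{Q}_p$-vector space $V$ is a function $N:V\to\mathbb{R}$ with $N(v)\ge0$, $N(v)=0$ iff $v=0$; $N(xv)=|x|_p N(v)$ for $x\in\mathbb{Q}_p$; and $N(v+w)\le\max\{N(v),N(w)\}$. For $\mathbb{Q}_p$-linearly independent $\alpha_1,\dots,\alpha_m\in V$, the $p$-adic lattice $\mathcal{L}(\alpha_1,\dots,\alpha_m)=\{\sum_{i=1}^m a_i\alpha_i: a_i\in\mathbb{Z}_p\}$. A lattice basis $\beta_1,\dots,\beta_m$ is an $N$-orthogonal basis if $N(\sum_i x_i\beta_i)=\max_i N(x_i\beta_i)$ for all $x_i\in\mathbb{Q}_p$. The Closest Vector Problem: given a basis of a $p$-adic lattice $\mathcal{L}$ and a target $t\in V$, find $v\in\mathcal{L}$ with $N(t-v)=\min_{w\in\mathcal{L}}N(t-w)$. *)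

(* Defs.v *)
From HB Require Import structures.
From mathcomp Require Import all_boot all_order all_algebra.
From mathcomp Require Import classical_sets reals.

Set Implicit Arguments.
Unset Strict Implicit.
Unset Printing Implicit Defensive.

Import Order.TTheory GRing.Theory Num.Theory.
Local Open Scope ring_scope.
Local Open Scope classical_set_scope.

(** * The field of p-adic numbers *)

Definition rat_abs (R : realType) (p : nat) (q : rat) : R :=
  if q == 0 then 0
  else p%:R ^+ logn p `|denq q|%N / p%:R ^+ logn p `|numq q|%N.

(* (K, absp) is the completion of (rat, |.|_p).  This determines Q_p with its
   absolute value up to a unique isometric isomorphism. *)
Record is_padic (R : realType) (p : nat) (K : fieldType) (absp : K -> R) :
    Prop := IsPadic {
  absp_ge0 : forall x, 0 <= absp x;
  absp_eq0 : forall x, absp x = 0 <-> x = 0;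
  abspM : forall x y, absp (x * y) = absp x * absp y;
  abspD : forall x y, absp (x + y) <= Num.max (absp x) (absp y);
  absp_rat : forall q : rat, absp (ratr q) = rat_abs R p q;
  absp_dense : forall x (e : R), 0 < e -> exists q : rat, absp (x - ratr q) < e;
  absp_complete : forall u : nat -> K,
    (forall e : R, 0 < e -> exists n : nat, forall i j : nat,
      (n <= i)%N -> (n <= j)%N -> absp (u i - u j) < e) ->
    exists l, forall e : R, 0 < e -> exists n : nat, forall i : nat,
      (n <= i)%N -> absp (u i - l) < e }.

(** * Normed spaces, lattices, orthogonal bases *)

Record is_norm (R : realType) (K : fieldType) (absp : K -> R)
    (V : lmodType K) (N : V -> R) : Prop := IsNorm {
  norm_ge0 : forall v, 0 <= N v;
  norm_eq0 : forall v, N v = 0 <-> v = 0;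
  normZ : forall x v, N (x *: v) = absp x * N v;
  normD : forall v w, N (v + w) <= Num.max (N v) (N w) }.

(* The prime p, the space V and the norm N bundled together.  The basis of V
   plays no mathematical role: it is the one in whose coordinates vectors are
   handed to, and returned by, algorithms. *)
Record normed_space (R : realType) := NormedSpace {
  residue_char : nat;
  residue_char_prime : prime residue_char;
  scalars : fieldType;
  absp : scalars -> R;
  abspP : is_padic residue_char absp;
  carrier :> vectType scalars;
  norm : carrier -> R;
  normP : is_norm absp norm;
  frame : (\dim {:carrier}).-tuple carrier;
  frameP : basis_of {:carrier} frame }.

Definition dimS (R : realType) (S : normed_space R) : nat := \dim {:S}.

(* Z_p is the closed unit ball of Q_p. *)
Definition lattice (R : realType) (S : normed_space R) (a : seq S) : set S :=
  [set v | exists c : 'I_(size a) -> scalars S,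
    (forall i, absp (c i) <= 1) /\ v = \sum_i c i *: a`_i].

Definition lattice_basis (R : realType) (S : normed_space R) (L : set S)
    (b : seq S) : Prop :=
  free b /\ lattice b = L.

(* All norms are nonnegative, so 0 is a neutral initial value for the max. *)
Definition orthogonal (R : realType) (S : normed_space R) (b : seq S) : Prop :=
  forall x : 'I_(size b) -> scalars S,
    norm (\sum_i x i *: b`_i) = \big[Num.max/0]_i norm (x i *: b`_i).

(** * The two computational problems *)

Record problem (R : realType) := Problem {
  instance : forall S : normed_space R, seq S -> Prop;
  solution : forall S : normed_space R, seq S -> seq S -> Prop }.

Definition orthogonalization (R : realType) : problem R := {|
  instance := fun S a => free a;
  solution := fun S a b => lattice_basis (lattice a) b /\ orthogonal b |}.

(* An instance is the target followed by the basis of the lattice. *)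
Definition closest_vector (R : realType) : problem R := {|
  instance := fun S s => exists t a, s = t :: a /\ free a;
  solution := fun S s out => exists t a v,
    [/\ s = t :: a, out = [:: v], lattice a v &
        forall w, lattice a w -> norm (t - v) <= norm (t - w)] |}.

(** * Algorithms: an oracle random-access machine over Q_p

  The machine has index registers (naturals), a memory of scalars addressed by
  naturals, and real registers, which can only receive values of |.|_p and N
  and be compared.  As in the Blum-Shub-Smale model, a field operation or a
  test on scalars is one step; index arithmetic is charged in unary, so that it
  provides no hidden computational power.  The same program runs over all
  normed spaces. *)

Inductive iexp :=
| IVar of nat
| ICst of nat
| IAdd of iexp & iexp
| ISub of iexp & iexp
| IMul of iexp & iexp.

Inductive scalar_op := OpAdd | OpSub | OpMul | OpDiv.

Inductive test :=
| TIndexLe of iexp & iexp      (* comparison of indices *)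
| TScalar0 of iexp             (* is the scalar at this address zero? *)
| TRealLe of nat & nat.        (* comparison of two real registers *)

Inductive cmd :=
| CSkip
| CSeq of cmd & cmd
| CIndex of nat & iexp                          (* register := expression *)
| COne of iexp                                  (* mem[d] := 1 *)
| COp of scalar_op & iexp & iexp & iexp         (* mem[d] := mem[a] op mem[b] *)
| CAbs of nat & iexp                            (* real r := |mem[a]|_p *)
| CNorm of nat & iexp                           (* real r := N(vector at a) *)
| COracle of iexp & iexp & iexp                 (* query the k vectors at a;
                                                   write the answer at d *)
| CIf of test & cmd & cmd
| CWhile of test & cmd.

Section Machine.
Variables (R : realType) (S : normed_space R).

Record state := State {
  idx : nat -> nat;
  mem : nat -> scalars S;
  rreg : nat -> R }.

Fixpoint ieval (f : nat -> nat) (e : iexp) : nat :=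
  match e with
  | IVar x => f x
  | ICst k => k
  | IAdd a b => ieval f a + ieval f b
  | ISub a b => ieval f a - ieval f b
  | IMul a b => ieval f a * ieval f b
  end%N.

Fixpoint icost (f : nat -> nat) (e : iexp) : nat :=
  (ieval f e).+1 +
  match e with
  | IVar _ | ICst _ => 0
  | IAdd a b | ISub a b | IMul a b => icost f a + icost f b
  end%N.

Definition op_eval (o : scalar_op) (x y : scalars S) : scalars S :=
  match o with
  | OpAdd => x + y | OpSub => x - y | OpMul => x * y | OpDiv => x / y
  end.

Definition test_eval (s : state) (t : test) : bool :=
  match t with
  | TIndexLe a b => (ieval (idx s) a <= ieval (idx s) b)%N
  | TScalar0 a => mem s (ieval (idx s) a) == 0
  | TRealLe r1 r2 => rreg s r1 <= rreg s r2
  end.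

Definition test_cost (s : state) (t : test) : nat :=
  match t with
  | TIndexLe a b => (icost (idx s) a + icost (idx s) b).+1
  | TScalar0 a => (icost (idx s) a).+1
  | TRealLe _ _ => 1
  end.

(* Vectors are stored as blocks of dimS S consecutive coordinates. *)
Definition encode (vs : seq S) : seq (scalars S) :=
  [seq coord (frame S) i v | v <- vs, i <- enum 'I_(\dim {:S})].

Definition read_vec (m : nat -> scalars S) (a : nat) : S :=
  \sum_(i < \dim {:S}) m (a + i)%N *: (frame S)`_i.

Definition read_vecs (m : nat -> scalars S) (k a : nat) : seq S :=
  [seq read_vec m (a + j * dimS S)%N | j <- iota 0 k].

Definition write (m : nat -> scalars S) (d : nat) (l : seq (scalars S)) :
    nat -> scalars S :=
  fun x => if (d <= x < d + size l)%N then l`_(x - d) else m x.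

Definition set_idx (s : state) (x k : nat) : state :=
  State [eta idx s with x |-> k] (mem s) (rreg s).
Definition set_mem (s : state) (d : nat) (l : seq (scalars S)) : state :=
  State (idx s) (write (mem s) d l) (rreg s).
Definition set_real (s : state) (r : nat) (y : R) : state :=
  State (idx s) (mem s) [eta rreg s with r |-> y].

Variables (norm_cost : S -> nat) (oracle : seq S -> seq S).

(* exec c s t s' : started in s, the program c halts in s' after t steps.
   A norm evaluation is charged norm_cost, an oracle call the total length of
   the query and of the answer. *)
Inductive exec : cmd -> state -> nat -> state -> Prop :=
| ExSkip s : exec CSkip s 1 s
| ExSeq c1 c2 s1 s2 s3 t1 t2 :
    exec c1 s1 t1 s2 -> exec c2 s2 t2 s3 -> exec (CSeq c1 c2) s1 (t1 + t2) s3
| ExIndex x e s :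
    exec (CIndex x e) s (icost (idx s) e).+1 (set_idx s x (ieval (idx s) e))
| ExOne d s :
    exec (COne d) s (icost (idx s) d).+1 (set_mem s (ieval (idx s) d) [:: 1])
| ExOp o d a b s :
    exec (COp o d a b) s
      (icost (idx s) d + icost (idx s) a + icost (idx s) b).+1
      (set_mem s (ieval (idx s) d)
         [:: op_eval o (mem s (ieval (idx s) a)) (mem s (ieval (idx s) b))])
| ExAbs r a s :
    exec (CAbs r a) s (icost (idx s) a).+1
      (set_real s r (absp (mem s (ieval (idx s) a))))
| ExNorm r a s :
    let v := read_vec (mem s) (ieval (idx s) a) in
    exec (CNorm r a) s (icost (idx s) a + dimS S + norm_cost v).+1
      (set_real s r (norm v))
| ExOracle k a d s :
    let query := read_vecs (mem s) (ieval (idx s) k) (ieval (idx s) a) in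
    let answer := oracle query in
    exec (COracle k a d) s
      (icost (idx s) k + icost (idx s) a + icost (idx s) d +
         dimS S * (size query + size answer)).+1
      (set_mem s (ieval (idx s) d) (encode answer))
| ExIfTrue b c1 c2 s s' t :
    test_eval s b -> exec c1 s t s' ->
    exec (CIf b c1 c2) s (test_cost s b + t) s'
| ExIfFalse b c1 c2 s s' t :
    ~~ test_eval s b -> exec c2 s t s' ->
    exec (CIf b c1 c2) s (test_cost s b + t) s'
| ExWhileEnd b c s :
    ~~ test_eval s b -> exec (CWhile b c) s (test_cost s b) s
| ExWhileStep b c s1 s2 s3 t1 t2 :
    test_eval s1 b -> exec c s1 t1 s2 -> exec (CWhile b c) s2 t2 s3 ->
    exec (CWhile b c) s1 (test_cost s1 b + t1 + t2) s3.

(* Initially index register 0 holds dim V, register 1 the number of input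
   vectors, and these vectors are stored from address 0 on; everything else is
   zero.  On halting, register 1 holds the number of output vectors, stored
   from address 0 on. *)
Definition init (vs : seq S) : state :=
  State (nth 0%N [:: dimS S; size vs]) (nth 0 (encode vs)) (fun=> 0).

Definition output (s : state) : seq S := read_vecs (mem s) (idx s 1) 0.

End Machine.

(** * Polynomial-time reductions

  F is a family of triples (p, V, N).  One program and one polynomial must serve
  all of F, every basis of every lattice and every correct oracle: as
  lattices in V have rank at most dim V, the time bound is asymptotic only when
  dim V varies over F.  F may consist of all triples, or fix p, or p and V.  Time is
  measured against dim V plus the number of input vectors, which is polynomially
  related to the number of input coordinates. *)

Section Reductions.
Variables (R : realType) (F : normed_space R -> Prop).
Variable norm_cost : forall S : normed_space R, S -> nat.

Definition efficient_norms : Prop :=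
  exists Q : {poly nat}, forall S, F S ->
    forall v : S, (norm_cost v <= Q.[dimS S])%N.

Definition solves (A : problem R) (S : normed_space R)
    (oracle : seq S -> seq S) : Prop :=
  forall x, instance A x -> solution A x (oracle x).

Definition poly_time_given_oracle (A B : problem R) : Prop :=
  exists (c : cmd) (P : {poly nat}), forall S, F S ->
    forall oracle : seq S -> seq S, solves B oracle ->
    forall x : seq S, instance A x ->
    exists t s, [/\ exec (@norm_cost S) oracle c (init x) t s,
                    (t <= P.[dimS S + size x])%N &
                    solution A x (output s)].

Definition poly_equivalent (A B : problem R) : Prop :=
  poly_time_given_oracle A B /\ poly_time_given_oracle B A.

End Reductions.

(* Main.v *)
(* Orthogonalization from closest vectors: keep an orthogonal family beta of
   lattice vectors for which the distance of every lattice vector to the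
   Q_p-span of beta is attained on its Z_p-span.  If v has maximal distance
   among the lattice vectors, then v minus its closest vector can be added to
   beta: modulo beta, subtracting a multiple c v with |c| > 1 only lengthens a
   lattice vector.  It is enough to maximize over the remaining basis vectors.

   Closest vectors from orthogonalization: if the target t is in the span of
   the lattice, round its coordinates in an orthogonal basis.  Otherwise take an
   orthogonal basis c of the lattice generated by t and the lattice; the vector
   t - v must have t-coordinate 1, so some c_i with unit t-coordinate has a unit
   coefficient in it, and the shortest such c_i, divided by its t-coordinate, is
   an optimal t - v.  Coordinates are found by Gauss-Jordan elimination. *)

Require Import Defs.
From mathcomp Require Import all_boot all_order all_algebra zify.
From mathcomp Require Import classical_sets reals.

Set Implicit Arguments.
Unset Strict Implicit.
Unset Printing Implicit Defensive.

Import Order.TTheory GRing.Theory Num.Theory.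
(* Again, so that Defs.mem and Defs.set_mem shadow their MathComp namesakes. *)
Import Defs.
Local Open Scope nat_scope.

(** No longest vector is ever selected in the orthogonalization: the current vector [p] is changed
    in place to [p - b_i], and to [p - 2 b_i] if the first change made it shorter than before, each
    time reduced by a closest vector. The result is at least as long as both [p] and [b_i] modulo
    [beta], for every prime, and the change is unimodular, so the lattice stays the same. In the
    elimination the rows of the matrix are the vectors, and only columns are changed. A column
    operation is a change of frame, so the vectors themselves never move; in the end the frame
    starts with the chosen free family and every row shows its coordinates in it. Time is controlled
    by a single number [b] above all index registers, loop lengths, vector counts and norm costs. A
    fixed program then takes at most a polynomial in [b], because all its loops are counting
    loops. *)

(** * Polynomially bounded functions *)

Definition poly_bounded (f : nat -> nat) : Prop :=
  exists P : {poly nat}, forall k, f k <= P.[k]%R.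

Lemma poly_bounded_cst c : poly_bounded (fun=> c).
Proof. by exists (c%:P)%R => k; rewrite hornerC. Qed.

Lemma poly_bounded_id : poly_bounded id.
Proof. by exists 'X%R => k; rewrite hornerX. Qed.

Lemma poly_boundedD f g :
  poly_bounded f -> poly_bounded g -> poly_bounded (fun k => f k + g k).
Proof.
by move=> [P hP] [Q hQ]; exists (P + Q)%R => k; rewrite hornerD leq_add.
Qed.

Lemma poly_boundedM f g :
  poly_bounded f -> poly_bounded g -> poly_bounded (fun k => f k * g k).
Proof.
by move=> [P hP] [Q hQ]; exists (P * Q)%R => k; rewrite hornerM leq_mul.
Qed.

Lemma poly_boundedS f : poly_bounded f -> poly_bounded (fun k => (f k).+1).
Proof.
move=> hf; have [P hP] := poly_boundedD (poly_bounded_cst 1) hf.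
by exists P => k; rewrite -add1n.
Qed.

Lemma leq_horner (P : {poly nat}) k l : k <= l -> P.[k]%R <= P.[l]%R.
Proof.
move=> kl; elim/poly_ind: P => [|P c ih]; first by rewrite !horner0.
by rewrite !hornerMXaddC leq_add2r leq_mul.
Qed.

(** * Time bounds of programs *)

(** Only registers stay below [b]; addresses are products of registers and may exceed it. Following
    the fixed expression still gives a polynomial in [b]. *)
Fixpoint ieval_bound (b : nat) (e : iexp) : nat :=
  match e with
  | IVar _ => b
  | ICst k => k
  | IAdd e1 e2 => ieval_bound b e1 + ieval_bound b e2
  | ISub e1 _ => ieval_bound b e1
  | IMul e1 e2 => ieval_bound b e1 * ieval_bound b e2
  end.

Fixpoint icost_bound (b : nat) (e : iexp) : nat :=
  (ieval_bound b e).+1 +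
  match e with
  | IVar _ | ICst _ => 0
  | IAdd e1 e2 | ISub e1 e2 | IMul e1 e2 =>
      icost_bound b e1 + icost_bound b e2
  end.

Definition test_bound (b : nat) (t : test) : nat :=
  match t with
  | TIndexLe e1 e2 => (icost_bound b e1 + icost_bound b e2).+1
  | TScalar0 e => (icost_bound b e).+1
  | TRealLe _ _ => 1
  end.

(* Running time of a program whose index registers, loop lengths, vector counts
   and norm costs all stay below b. *)
Fixpoint time_bound (b : nat) (c : cmd) : nat :=
  match c with
  | CSkip => 1
  | CSeq c1 c2 => time_bound b c1 + time_bound b c2
  | CIndex _ e | COne e | CAbs _ e => (icost_bound b e).+1
  | COp _ d e1 e2 =>
      (icost_bound b d + icost_bound b e1 + icost_bound b e2).+1
  | CNorm _ e => (icost_bound b e + b + b).+1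
  | COracle k a d =>
      (icost_bound b k + icost_bound b a + icost_bound b d + b * (b + b)).+1
  | CIf t c1 c2 => test_bound b t + (time_bound b c1 + time_bound b c2)
  | CWhile t c => b.+1 * (test_bound b t + time_bound b c)
  end.

Lemma ieval_leq b f e : (forall x, f x <= b) -> ieval f e <= ieval_bound b e.
Proof.
move=> fb; elim: e => //= e1 h1 e2 h2; first exact: leq_add.
- exact: leq_trans (leq_subr _ _) h1.
- exact: leq_mul.
Qed.

Lemma icost_leq b f e : (forall x, f x <= b) -> icost f e <= icost_bound b e.
Proof.
move=> fb; have hb e' := ieval_leq e' fb.
elim: e => [x|k|e1 h1 e2 h2|e1 h1 e2 h2|e1 h1 e2 h2].
- exact: leq_add (hb (IVar x)) _.
- by [].
- exact: leq_add (hb (IAdd e1 e2)) (leq_add h1 h2).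
- exact: leq_add (hb (ISub e1 e2)) (leq_add h1 h2).
- exact: leq_add (hb (IMul e1 e2)) (leq_add h1 h2).
Qed.

Section TimePolynomial.
Variable b : nat -> nat.
Hypothesis hb : poly_bounded b.

Lemma poly_bounded_ieval e : poly_bounded (fun k => ieval_bound (b k) e).
Proof.
elim: e => [x|c|e1 h1 e2 h2|e1 h1 e2 h2|e1 h1 e2 h2] //=.
- exact: poly_bounded_cst.
- exact: poly_boundedD.
- exact: poly_boundedM.
Qed.

Lemma poly_bounded_icost e : poly_bounded (fun k => icost_bound (b k) e).
Proof.
have h e' := poly_boundedS (poly_bounded_ieval e').
elim: e => [x|c|e1 h1 e2 h2|e1 h1 e2 h2|e1 h1 e2 h2].
- exact: poly_boundedD (h (IVar x)) (poly_bounded_cst 0).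
- exact: poly_boundedD (h (ICst c)) (poly_bounded_cst 0).
- exact: poly_boundedD (h (IAdd e1 e2)) (poly_boundedD h1 h2).
- exact: poly_boundedD (h (ISub e1 e2)) (poly_boundedD h1 h2).
- exact: poly_boundedD (h (IMul e1 e2)) (poly_boundedD h1 h2).
Qed.

Lemma poly_bounded_test t : poly_bounded (fun k => test_bound (b k) t).
Proof.
case: t => [e1 e2|e|r1 r2] /=.
- by apply/poly_boundedS/poly_boundedD; exact: poly_bounded_icost.
- by apply/poly_boundedS; exact: poly_bounded_icost.
- exact: poly_bounded_cst.
Qed.

Lemma poly_bounded_time c : poly_bounded (fun k => time_bound (b k) c).
Proof.
elim: c => [|c1 h1 c2 h2|x e|e|o d e1 e2|r e|r e|k a d|t c1 h1 c2 h2|t c h] /=;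
  repeat first [ exact: poly_bounded_cst | exact: poly_bounded_icost
    | exact: poly_bounded_test | assumption | apply: poly_boundedS
    | apply: poly_boundedD | apply: poly_boundedM ].
Qed.

End TimePolynomial.

(** * A calculus of weakest preconditions with running time *)

Definition CFor (r : nat) (e : iexp) (c : cmd) : cmd :=
  CSeq (CIndex r (ICst 0))
    (CWhile (TIndexLe (IAdd (IVar r) (ICst 1)) e)
       (CSeq c (CIndex r (IAdd (IVar r) (ICst 1))))).

Section WeakestPrecondition.
Variables (R : realType) (S : normed_space R).
Variables (norm_cost : S -> nat) (oracle : seq S -> seq S) (b : nat).
Hypothesis norm_cost_leq : forall v, norm_cost v <= b.
Hypothesis dim_leq : dimS S <= b.

Definition bounded (s : state S) : Prop := forall x, idx s x <= b.

(** Total correctness together with the time bound. Boundedness of the registers is both assumed and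
    re-established here, so that no loop invariant has to mention it. *)
Definition wp (c : cmd) (s : state S) (Q : state S -> Prop) : Prop :=
  bounded s -> exists t s', [/\ exec norm_cost oracle c s t s',
    t <= time_bound b c, bounded s' & Q s'].

Lemma wp_mono c s (Q Q' : state S -> Prop) :
  (forall s', Q s' -> Q' s') -> wp c s Q -> wp c s Q'.
Proof.
move=> QQ' h /h [t [s' [? ? ? /QQ' ?]]]; by exists t, s'.
Qed.

Lemma wp_skip s (Q : state S -> Prop) : Q s -> wp CSkip s Q.
Proof. by move=> Qs bs; exists 1, s; split => //; constructor. Qed.

Lemma wp_seq c1 c2 s Q :
  wp c1 s (fun s' => wp c2 s' Q) -> wp (CSeq c1 c2) s Q.
Proof.
move=> h /h [t1 [s1 [e1 l1 b1 /(_ b1) [t2 [s2 [e2 l2 b2 Q2]]]]]].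
exists (t1 + t2), s2; split => //; last exact: leq_add.
exact: ExSeq e1 e2.
Qed.

Lemma wp_index x e s (Q : state S -> Prop) :
  ieval (idx s) e <= b -> Q (set_idx s x (ieval (idx s) e)) ->
  wp (CIndex x e) s Q.
Proof.
move=> eb Qs bs; exists (icost (idx s) e).+1, (set_idx s x (ieval (idx s) e)).
split => //; first exact: ExIndex.
- by rewrite ltnS icost_leq.
- by move=> y /=; case: ifP.
Qed.

Lemma wp_one d s (Q : state S -> Prop) :
  Q (set_mem s (ieval (idx s) d) [:: 1%R]) -> wp (COne d) s Q.
Proof.
move=> Qs bs; eexists; eexists; split; [exact: ExOne| |by []|by []].
by rewrite ltnS icost_leq.
Qed.

Lemma wp_op o d e1 e2 s (Q : state S -> Prop) :
  Q (set_mem s (ieval (idx s) d) [:: op_eval o (mem s (ieval (idx s) e1))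
       (mem s (ieval (idx s) e2))]) -> wp (COp o d e1 e2) s Q.
Proof.
move=> Qs bs; eexists; eexists; split; [exact: ExOp| |by []|by []].
by rewrite ltnS !leq_add ?icost_leq.
Qed.

Lemma wp_abs r e s (Q : state S -> Prop) :
  Q (set_real s r (absp (mem s (ieval (idx s) e)))) -> wp (CAbs r e) s Q.
Proof.
move=> Qs bs; eexists; eexists; split; [exact: ExAbs| |by []|by []].
by rewrite ltnS icost_leq.
Qed.

Lemma wp_norm r e s (Q : state S -> Prop) :
  Q (set_real s r (norm (read_vec (mem s) (ieval (idx s) e)))) ->
  wp (CNorm r e) s Q.
Proof.
move=> Qs bs; eexists; eexists; split; [exact: ExNorm| |by []|by []].
by rewrite ltnS !leq_add ?icost_leq.
Qed.

Lemma wp_oracle k a d s (Q : state S -> Prop) :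
  let query := read_vecs (mem s) (ieval (idx s) k) (ieval (idx s) a) in
  ieval (idx s) k <= b -> size (oracle query) <= b ->
  Q (set_mem s (ieval (idx s) d) (encode (oracle query))) ->
  wp (COracle k a d) s Q.
Proof.
move=> query kb ob Qs bs; eexists; eexists; split; [exact: ExOracle| |by []|by []].
rewrite ltnS !leq_add ?icost_leq // leq_mul // leq_add //.
by rewrite size_map size_iota.
Qed.

Lemma test_leq s t : bounded s -> test_cost s t <= test_bound b t.
Proof.
by move=> bs; case: t => [e1 e2|e|] //=; rewrite ltnS ?leq_add ?icost_leq.
Qed.

Lemma wp_if t c1 c2 s (Q : state S -> Prop) :
  (test_eval s t -> wp c1 s Q) -> (~~ test_eval s t -> wp c2 s Q) ->
  wp (CIf t c1 c2) s Q.
Proof.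
move=> h1 h2 bs; have tb := test_leq t bs; case: (boolP (test_eval s t)) => ht.
- have [u [s' [e l b' Q']]] := h1 ht bs.
  exists (test_cost s t + u), s'; split => //; first exact: ExIfTrue.
  by rewrite /= leq_add // (leq_trans l) ?leq_addr.
- have [u [s' [e l b' Q']]] := h2 ht bs.
  exists (test_cost s t + u), s'; split => //; first exact: ExIfFalse.
  by rewrite /= leq_add // (leq_trans l) ?leq_addl.
Qed.

(** The limit [e] is evaluated anew before every pass, so the invariant must pin its value to [k];
    the body must give the counter back unchanged. *)
Lemma wp_for r e c s k (I : nat -> state S -> Prop) (Q : state S -> Prop) :
  k <= b ->
  (forall i s', I i s' -> ieval (idx s') e = k) ->
  I 0 (set_idx s r 0) ->
  (forall i s', i < k -> idx s' r = i -> I i s' ->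
     wp c s' (fun s2 => idx s2 r = i /\ I i.+1 (set_idx s2 r i.+1))) ->
  (forall s', idx s' r = k -> I k s' -> Q s') ->
  wp (CFor r e c) s Q.
Proof.
move=> kb ek I0 IS IQ; apply/wp_seq/wp_index => //.
move: I0; rewrite [ieval _ _]/=; set s0 := set_idx s r 0.
have r0 : idx s0 r = 0 by rewrite /= eqxx.
clearbody s0 => I0 bs0; rewrite [time_bound _ _]/=.
set T := (X in b.+1 * X).
(* Induction on the number [j] of remaining passes; the extra unit in [j.+1] pays for the final
   failing test. *)
suff h j i s1 : k = i + j -> idx s1 r = i -> I i s1 -> bounded s1 ->
    exists t s', [/\ exec norm_cost oracle (CWhile
       (TIndexLe (IAdd (IVar r) (ICst 1)) e)
       (CSeq c (CIndex r (IAdd (IVar r) (ICst 1))))) s1 t s',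
       t <= j.+1 * T, bounded s' & Q s'].
  have [t [s' [e' l b' Q']]] := h k 0 s0 erefl r0 I0 bs0.
  exists t, s'; split => //; apply: (leq_trans l).
  by rewrite leq_mul2r ltnS kb orbT.
elim: j i s1 => [|j ih] i s1 kE ri Ii b1.
  rewrite addn0 in kE; exists (test_cost s1 (TIndexLe (IAdd (IVar r) (ICst 1)) e)), s1.
  split => //.
  - by apply: ExWhileEnd; rewrite /= (ek _ _ Ii) ri kE addn1 ltnn.
  - by rewrite mul1n (leq_trans (test_leq _ b1)) ?leq_addr.
  - by apply: IQ; rewrite ?kE.
have ik : i < k by rewrite kE addnS ltnS leq_addr.
have [t2 [s2 [e2 l2 b2 [r2 I2]]]] := IS i s1 ik ri Ii b1.
have := @wp_index r (IAdd (IVar r) (ICst 1)) s2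
  (fun s' => idx s' r = i.+1 /\ I i.+1 s').
rewrite /= r2 addn1 => /(_ (leq_trans ik kb)) /(_ _ b2).
rewrite eqxx => -[//|t3 [s3 [e3 l3 b3 [r3 I3]]]].
have [|t4 [s4 [e4 l4 b4 Q4]]] := ih i.+1 s3 _ r3 I3 b3; first by rewrite kE addnS.
eexists; exists s4; split; [apply: ExWhileStep; last exact: e4| |by []|by []].
- by rewrite /= (ek _ _ Ii) ri addn1.
- exact: ExSeq e2 e3.
- rewrite (mulSn j.+1) leq_add // /T leq_add ?test_leq //.
  exact: leq_add.
Qed.

Lemma write1E (m : nat -> scalars S) d v x :
  write m d [:: v] x = if x == d then v else m x.
Proof.
rewrite /write /= addn1 ltnS -eqn_leq eq_sym.
by case: eqP => // ->; rewrite subnn.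
Qed.

(** The loop acts as one simultaneous assignment because no cell written in pass [i] is read or
    written in a later pass [j]. Comparing only [i < j] admits updates in place, where [D] equals
    [A]. *)
Lemma wp_parallel r e o d a c s k (D A C : nat -> nat) (Q : state S -> Prop) :
  k <= b ->
  (forall f i, (forall x, x != r -> f x = idx s x) -> f r = i ->
     [/\ ieval f e = k, ieval f d = D i, ieval f a = A i & ieval f c = C i]) ->
  (forall i j, i < j -> j < k -> [/\ D i != D j, D i != A j & D i != C j]) ->
  (forall s', (forall x, x != r -> idx s' x = idx s x) -> rreg s' = rreg s ->
     (forall j, j < k ->
        mem s' (D j) = op_eval o (mem s (A j)) (mem s (C j))) ->
     (forall x, (forall j, j < k -> x != D j) -> mem s' x = mem s x) ->
     Q s') ->
  wp (CFor r e (COp o d a c)) s Q.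
Proof.
move=> kb he hD hQ.
apply: (@wp_for _ _ _ _ k (fun i s' =>
   [/\ forall x, x != r -> idx s' x = idx s x, rreg s' = rreg s,
       forall j, j < i ->
          mem s' (D j) = op_eval o (mem s (A j)) (mem s (C j)) &
       forall x, (forall j, j < i -> x != D j) -> mem s' x = mem s x])) => //.
- by move=> i s' [hx _ _ _]; have [] := he _ _ hx erefl.
- by split => // x /= /negPf ->.
- move=> i s' ik ri [hx hr h1 h2]; apply: wp_op.
  have [_ -> -> ->] := he _ _ hx ri; split; first by rewrite /= ri.
  split => //=.
  + by move=> x xr; rewrite (negPf xr) hx.
  + move=> j; rewrite ltnS leq_eqVlt write1E => /orP[/eqP->|ji].
      by rewrite eqxx !h2 // => l li; have [_] := hD _ _ li ik;
        rewrite ![D l == _]eq_sym.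
    have [/negPf -> _ _] := hD _ _ ji ik; exact: h1.
  + move=> x hxx; rewrite write1E (negPf (hxx i (ltnSn i))) h2 // => j ji.
    exact/hxx/(ltn_trans ji).
- by move=> s' _ []; exact: hQ.
Qed.

End WeakestPrecondition.

(** * Ultrametric norms and lattices *)

Section Ultrametric.
Variables (R : realType) (S : normed_space R).
Local Notation K := (scalars S).
Local Notation n := (dimS S).
Local Open Scope ring_scope.
Implicit Types (u v w : S) (b : seq S) (c : K) (z : nat -> K).

Lemma norm_nneg v : 0 <= norm v. Proof. exact: norm_ge0 (normP S) v. Qed.

Lemma absp_nneg c : 0 <= absp c. Proof. exact: absp_ge0 (abspP S) c. Qed.

Lemma norm_is0 v : (norm v == 0) = (v == 0).
Proof. by apply/eqP/eqP => /(norm_eq0 (normP S)). Qed.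

Lemma abspMr c d : absp (c * d) = absp c * absp d.
Proof. exact: abspM (abspP S) c d. Qed.

Lemma normZr c v : norm (c *: v) = absp c * norm v.
Proof. exact: normZ (normP S) c v. Qed.

Lemma norm0 : norm (0 : S) = 0.
Proof. by apply/eqP; rewrite norm_is0. Qed.

Lemma absp0 : absp (0 : K) = 0.
Proof. by apply/(absp_eq0 (abspP S)). Qed.

Lemma absp_gt0 c : c != 0 -> 0 < absp c.
Proof.
move=> c0; rewrite lt_def absp_nneg andbT.
by apply: contra c0 => /eqP /(absp_eq0 (abspP S)) ->.
Qed.

Lemma absp1 : absp (1 : K) = 1.
Proof.
have a0 := absp_gt0 (oner_neq0 K).
by apply: (mulfI (lt0r_neq0 a0)); rewrite -abspMr !mulr1.
Qed.

Lemma abspV c : c != 0 -> absp c^-1 = (absp c)^-1.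
Proof.
move=> c0; have a0 := lt0r_neq0 (absp_gt0 c0).
by apply: (mulfI a0); rewrite -abspMr !divff // absp1.
Qed.

Lemma abspN1 : absp (-1 : K) = 1.
Proof.
have /eqP : absp (-1 : K) ^+ 2 = 1 by rewrite expr2 -abspMr mulN1r opprK absp1.
by rewrite sqrf_eq1 => /orP[/eqP //|/eqP h]; have := absp_nneg (-1);
  rewrite h oppr_ge0 ler10.
Qed.

Lemma abspD_le c d (r : R) : absp c <= r -> absp d <= r -> absp (c + d) <= r.
Proof.
by move=> cr dr; apply: le_trans (abspD (abspP S) c d) _; rewrite ge_max cr.
Qed.

Lemma normN v : norm (- v) = norm v.
Proof. by rewrite -scaleN1r normZr abspN1 mul1r. Qed.

Lemma normD_le u v (r : R) : norm u <= r -> norm v <= r -> norm (u + v) <= r.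
Proof.
by move=> ur vr; apply: le_trans (normD (normP S) u v) _; rewrite ge_max ur.
Qed.

Lemma normB_le u v (r : R) : norm u <= r -> norm v <= r -> norm (u - v) <= r.
Proof. by move=> ur vr; apply: normD_le; rewrite ?normN. Qed.

Lemma normZ_le c v (r : R) : absp c <= 1 -> norm v <= r -> norm (c *: v) <= r.
Proof.
by move=> c1 vr; apply: le_trans vr; rewrite normZr ler_piMl ?norm_nneg.
Qed.

(** Coefficients are indexed by naturals, so that removing the head of the family is a mere
    shift. *)
Definition comb (z : nat -> K) (b : seq S) : S := \sum_(i < size b) z i *: b`_i.

Lemma comb_cons z v b : comb z (v :: b) = z 0%N *: v + comb (fun i => z i.+1) b.
Proof. by rewrite /comb /= big_ord_recl. Qed.

Lemma combD z z' b : comb z b + comb z' b = comb (fun i => z i + z' i) b.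
Proof. by rewrite /comb -big_split; apply: eq_bigr => i _; rewrite scalerDl. Qed.

Lemma combZ c z b : c *: comb z b = comb (fun i => c * z i) b.
Proof. by rewrite /comb scaler_sumr; apply: eq_bigr => i _; rewrite scalerA. Qed.

Lemma combN z b : - comb z b = comb (fun i => - z i) b.
Proof. by rewrite /comb -sumrN; apply: eq_bigr => i _; rewrite scaleNr. Qed.

Lemma comb_delta b j : (j < size b)%N -> b`_j = comb (fun i => (i == j)%:R) b.
Proof.
move=> jb; rewrite /comb (bigD1 (Ordinal jb)) //= eqxx scale1r big1 ?addr0 //.
by move=> i /negPf; rewrite -val_eqE /= => ->; rewrite scale0r.
Qed.

Lemma eq_comb z z' b :
  (forall i, (i < size b)%N -> z i = z' i) -> comb z b = comb z' b.
Proof. by move=> h; apply: eq_bigr => i _; rewrite h. Qed.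

Lemma comb_inj z z' b : free b -> comb z b = comb z' b ->
  forall i, (i < size b)%N -> z i = z' i.
Proof.
move=> fb /eqP; rewrite -subr_eq0 combN combD => /eqP zz i ib.
have /freeP/(_ (fun i => z i - z' i))/(_ zz)/(_ (Ordinal ib)) : free (in_tuple b).
  by [].
by move=> /eqP; rewrite subr_eq0 => /eqP.
Qed.

Lemma mem_spanP b v : v \in <<b>>%VS -> exists z, v = comb z b.
Proof.
move=> /(@coord_span _ _ _ (in_tuple b)) {1}->.
exists (fun i => if insub i is Some j then coord (in_tuple b) j v else 0).
by apply: eq_bigr => i _; rewrite valK.
Qed.

Lemma comb_span z b : comb z b \in <<b>>%VS.
Proof.
by apply: memv_suml => i _; apply/memvZ/memv_span/mem_nth.
Qed.

Lemma latticeP b v : lattice b v <->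
  exists z, (forall i, (i < size b)%N -> absp (z i) <= 1) /\ v = comb z b.
Proof.
split=> [[c [c1 ->]]|[z [z1 ->]]]; last first.
  by exists (fun i => z i); split => // i; apply: z1.
exists (fun i => if insub i is Some j then c j else 0); split => [i ib|].
  by rewrite insubT; exact: c1.
by apply: eq_bigr => i _; rewrite valK.
Qed.

Lemma lattice0 b : lattice b 0.
Proof.
apply/latticeP; exists (fun=> 0); split => [i _|]; first by rewrite absp0.
by rewrite /comb big1 // => i _; rewrite scale0r.
Qed.

Lemma latticeD b u v : lattice b u -> lattice b v -> lattice b (u + v).
Proof.
move=> /latticeP[z [z1 ->]] /latticeP[y [y1 ->]]; apply/latticeP.
exists (fun i => z i + y i); rewrite combD; split => // i ib.
by apply: abspD_le; auto.
Qed.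

Lemma latticeZ b c v : absp c <= 1 -> lattice b v -> lattice b (c *: v).
Proof.
move=> c1 /latticeP[z [z1 ->]]; apply/latticeP.
exists (fun i => c * z i); rewrite combZ; split => // i ib.
by rewrite abspMr mulr_ile1 ?absp_nneg ?z1.
Qed.

Lemma latticeN b v : lattice b v -> lattice b (- v).
Proof. by rewrite -scaleN1r; apply: latticeZ; rewrite abspN1. Qed.

Lemma latticeB b u v : lattice b u -> lattice b v -> lattice b (u - v).
Proof. by move=> ? /latticeN; exact: latticeD. Qed.

Lemma lattice_mem b v : v \in b -> lattice b v.
Proof.
move=> vb; rewrite -(nth_index 0 vb) comb_delta ?index_mem //; apply/latticeP.
eexists; split; last by [].
by move=> i _ /=; case: eqP => _; rewrite ?absp1 ?absp0.
Qed.

Lemma lattice_ind b (P : S -> Prop) :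
  P 0 -> (forall u v, P u -> P v -> P (u + v)) ->
  (forall c v, absp c <= 1 -> P v -> P (c *: v)) ->
  (forall v, v \in b -> P v) -> forall v, lattice b v -> P v.
Proof.
move=> P0 PD PZ Pb v [c [c1 ->]]; apply: (big_ind P) => // i _.
by apply: PZ => //; apply/Pb/mem_nth.
Qed.

Lemma lattice_sub b b' : (forall v, v \in b -> lattice b' v) ->
  forall v, lattice b v -> lattice b' v.
Proof.
move=> h; apply: lattice_ind => //; [exact: lattice0|exact: latticeD|].
exact: latticeZ.
Qed.

Lemma eq_lattice b b' : (forall v, v \in b -> lattice b' v) ->
  (forall v, v \in b' -> lattice b v) -> lattice b = lattice b'.
Proof. by move=> h h'; apply/seteqP; split => v; apply: lattice_sub. Qed.

Lemma lattice_span b v : lattice b v -> v \in <<b>>%VS.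
Proof. by move=> /latticeP[z [_ ->]]; exact: comb_span. Qed.

Lemma eq_lattice_span b b' : lattice b = lattice b' -> <<b>>%VS = <<b'>>%VS.
Proof.
move=> bb; apply/eqP; rewrite eqEsubv; apply/andP; split;
  apply/span_subvP => v /lattice_mem; [rewrite bb|rewrite -bb];
  exact: lattice_span.
Qed.

Lemma free_size_span b b' : <<b>>%VS = <<b'>>%VS -> size b = size b' ->
  free b' -> free b.
Proof. by rewrite /free => -> ->. Qed.

Lemma lattice_basis_size a b :
  free a -> lattice_basis (lattice a) b -> size b = size a.
Proof.
by move=> /eqP <- [/eqP <- /eq_lattice_span ->].
Qed.

Lemma orthogonalP b : orthogonal b <-> forall z,
  norm (comb z b) = \big[Num.max/0]_(i < size b) norm (z i *: b`_i).
Proof.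
split=> [h z|h x]; first exact: h.
have := h (fun i => if insub i is Some j then x j else 0).
rewrite /comb; under eq_bigr do rewrite valK.
by under [in X in _ = X -> _]eq_bigr do rewrite valK.
Qed.

Lemma orthogonal_nil : orthogonal ([::] : seq S).
Proof. by apply/orthogonalP => z; rewrite /comb !big_ord0 norm0. Qed.

(** By homogeneity [c *: v] is no longer than [c *: v + y] for any [y] in the span of [b]; then
    neither is [y], the difference of these two vectors. *)
Lemma orthogonal_cons v b : orthogonal b ->
  (forall z, norm v <= norm (v - comb z b)) -> orthogonal (v :: b).
Proof.
move=> /orthogonalP ob vb; apply/orthogonalP => z.
rewrite comb_cons /= big_ord_recl /= -(ob (fun i => z i.+1)).
set y := comb _ b; set c := z 0%N.
have cy : norm (c *: v) <= norm (c *: v + y).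
  have [->|c0] := eqVneq c 0; first by rewrite scale0r norm0 norm_nneg.
  have -> : c *: v + y = c *: (v - comb (fun i => - (c^-1 * z i.+1)) b).
    by rewrite -combN opprK -combZ scalerDr scalerA divff // scale1r.
  by rewrite !normZr ler_wpM2l ?absp_nneg.
apply/eqP; rewrite eq_le (normD (normP S)) ge_max cy /=.
by rewrite -[X in norm X <= _](addrK (c *: v)) [y + _]addrC normB_le.
Qed.

Lemma ler_bigmax m (f : 'I_m -> R) i : f i <= \big[Num.max/0]_j f j.
Proof. by rewrite (bigD1 i) //= le_max lexx. Qed.

Lemma bigmax_ler m (f : 'I_m -> R) r :
  0 <= r -> (forall i, f i <= r) -> \big[Num.max/0]_j f j <= r.
Proof.
move=> r0 fr; apply: (big_ind (fun x => x <= r)) => // x y xr yr.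
by rewrite ge_max xr.
Qed.

End Ultrametric.

(** * Vectors in memory *)

Section Memory.
Variables (R : realType) (S : normed_space R).
Local Notation K := (scalars S).
Implicit Types (m : nat -> K) (vs : seq S).

Lemma size_encode vs : size (encode vs) = size vs * dimS S.
Proof. by rewrite size_allpairs -cardE card_ord. Qed.

Lemma nth_encode vs j l (ln : l < dimS S) : j < size vs ->
  ((encode vs)`_(j * dimS S + l) = coord (frame S) (Ordinal ln) vs`_j)%R.
Proof.
elim: vs j => [//|v vs ih] [|j] /= jv.
  rewrite /encode /= nth_cat size_map -cardE card_ord ln.
  rewrite (nth_map (Ordinal ln)) -?cardE ?card_ord //.
  by congr (coord _ _ _); apply: val_inj; rewrite /= nth_enum_ord.
rewrite /encode /= nth_cat size_map -cardE card_ord mulSn -addnA.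
by rewrite ltnNge leq_addr /= addKn ih.
Qed.

Lemma eq_read_vec m m' a a' :
  (forall l, l < dimS S -> m (a + l) = m' (a' + l)) ->
  read_vec m a = read_vec m' a'.
Proof. by move=> h; apply: eq_bigr => i _; rewrite h. Qed.

Lemma read_vecB m m1 m2 a a1 a2 (c : K) :
  (forall l, l < dimS S -> m (a + l) = (m1 (a1 + l) - c * m2 (a2 + l))%R) ->
  (read_vec m a = read_vec m1 a1 - c *: read_vec m2 a2)%R.
Proof.
move=> h; rewrite /read_vec scaler_sumr -sumrB; apply: eq_bigr => i _.
by rewrite h // scalerBl scalerA.
Qed.

Lemma read_vec_encode m a vs j :
  (forall x, x < size vs * dimS S -> m (a + x) = ((encode vs)`_x)%R) ->
  j < size vs -> read_vec m (a + j * dimS S) = (vs`_j)%R.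
Proof.
move=> h jv; rewrite [RHS](coord_basis (frameP S) (memvf _)).
apply: eq_bigr => i _; rewrite -addnA h.
  by rewrite nth_encode //; congr (coord _ _ _ *: _)%R; exact: val_inj.
by have := ltn_ord i; rewrite /dimS; nia.
Qed.

Lemma write_in m d (l : seq K) x :
  x < size l -> write m d l (d + x) = (l`_x)%R.
Proof. by move=> xl; rewrite /write leq_addr ltn_add2l xl /= addKn. Qed.

Lemma write_out m d (l : seq K) x :
  (x < d) || (d + size l <= x) -> write m d l x = m x.
Proof. by move=> h; rewrite /write ifF //; lia. Qed.

Lemma read_vec_write m d vs j : j < size vs ->
  read_vec (write m d (encode vs)) (d + j * dimS S) = (vs`_j)%R.
Proof.
by move=> jv; apply: read_vec_encode jv => x xv;
  rewrite write_in // size_encode.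
Qed.

Lemma read_vec_init vs j : j < size vs ->
  read_vec (mem (init vs)) (j * dimS S) = (vs`_j)%R.
Proof.
by move=> jv; rewrite -[_ * _]add0n; apply: read_vec_encode.
Qed.

Lemma eq_read_vecs m k a vs : size vs = k ->
  (forall j, j < k -> read_vec m (a + j * dimS S) = (vs`_j)%R) ->
  read_vecs m k a = vs.
Proof.
move=> sv h; apply: (@eq_from_nth _ 0%R); rewrite size_map size_iota // => j jk.
by rewrite (nth_map 0) ?size_iota // nth_iota // h.
Qed.

End Memory.

Section BlockOperations.
Variables (R : realType) (S : normed_space R).
Variables (norm_cost : S -> nat) (oracle : seq S -> seq S) (b : nat).
Hypothesis dim_leq : dimS S <= b.
Local Notation wp := (wp norm_cost oracle b).

Definition CSubBlock (r : nat) (d a : iexp) : cmd :=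
  CFor r (IVar 0) (COp OpSub (IAdd d (IVar r)) (IAdd d (IVar r))
                      (IAdd a (IVar r))).

Lemma wp_sub_block r d a s D A (Q : state S -> Prop) :
  r != 0 -> idx s 0 = dimS S ->
  (forall f, (forall x, x != r -> f x = idx s x) ->
     ieval f d = D /\ ieval f a = A) ->
  (D + dimS S <= A) || (A + dimS S <= D) ->
  (forall s', (forall x, x != r -> idx s' x = idx s x) -> rreg s' = rreg s ->
     (read_vec (mem s') D = read_vec (mem s) D - read_vec (mem s) A)%R ->
     (forall x, (x < D) || (D + dimS S <= x) -> mem s' x = mem s x) ->
     Q s') ->
  wp (CSubBlock r d a) s Q.
Proof.
move=> r0 sn he DA hQ.
apply: (@wp_parallel _ _ _ _ _ _ _ _ _ _ _ _ (dimS S)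
  (fun l => D + l) (fun l => D + l) (fun l => A + l)) => //.
- move=> f i hf fr; have [/= -> ->] := he f hf.
  by rewrite fr hf // eq_sym.
- by move=> i j ij jn; split; lia.
- move=> s' hi hr hin hout; apply: hQ => // [|x hx].
    rewrite -[X in (_ - X)%R]scale1r.
    by apply: read_vecB => l ln; rewrite hin // mul1r.
  by apply: hout => j jn; lia.
Qed.

End BlockOperations.

(** * Orthogonalization with a closest vector oracle *)

Section SuccessiveMaxima.
Variables (R : realType) (S : normed_space R).
Local Open Scope ring_scope.
Implicit Types (a p u v w : S) (b beta l : seq S).

Definition attains_distance l beta : Prop := forall a, lattice l a ->
  forall z, exists w, lattice beta w /\ norm (a - w) <= norm (a - comb z beta).

Definition within beta (r : R) a : Prop :=
  exists w, lattice beta w /\ norm (a - w) <= r.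

Definition reduced beta p : Prop := forall z, norm p <= norm (p - comb z beta).

Lemma attains_distance_nil l : attains_distance l [::].
Proof.
move=> a la z; exists 0; split; first exact: lattice0.
by rewrite /comb big_ord0.
Qed.

Lemma attains_distance_cons l beta v :
  attains_distance l beta -> lattice l v -> v != 0 -> reduced beta v ->
  (forall a, lattice l a -> within beta (norm v) a) ->
  attains_distance l (v :: beta).
Proof.
move=> al lv v0 rv hv a la z; rewrite comb_cons; set c := z 0%N.
have sub_beta w : lattice beta w -> lattice (v :: beta) w.
  by apply: lattice_sub => x xb; apply: lattice_mem; rewrite inE xb orbT.
have lcv : absp c <= 1 -> lattice (v :: beta) (c *: v).
  by move=> c1; apply: latticeZ => //; apply: lattice_mem; rewrite mem_head.
have [c1|c1] := lerP (absp c) 1.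
  have [w [bw wz]] := al (a - c *: v) (latticeB la (latticeZ c1 lv))
    (fun i => z i.+1).
  exists (c *: v + w); rewrite !opprD !addrA; split => //.
  by apply: latticeD; [exact: lcv|exact: sub_beta].
have [w [bw wv]] := hv a la; exists w; split; first exact: sub_beta.
set y := comb _ beta; rewrite opprD addrA; set r := a - c *: v - y.
have c0 : c != 0 by apply: contraTneq c1 => ->; rewrite absp0 ltr10.
have [x [_ wE]] := (latticeP _ _).1 bw.
(* Divided by [c], this vector is [v] minus a combination of [beta], hence no shorter than the
   reduced [v]; multiplying by [c] lengthens it strictly. *)
have big : norm v < norm (c *: v + y - w).
  have -> : c *: v + y - w =
      c *: (v - comb (fun i => c^-1 * (x i - z i.+1)) beta).
    rewrite -combZ -combD -combN -wE -/y scalerBr scalerA divff // scale1r.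
    by rewrite opprB addrA.
  rewrite normZr (lt_le_trans (_ : _ < absp c * norm v)) //.
    by rewrite ltr_pMl // lt_def norm_nneg norm_is0 v0.
  by rewrite ler_wpM2l ?absp_nneg.
(* Since [a - w] is no longer than [v], it cannot account for this norm. So [r] does, and [w]
   approximates [a] at least as well as the given combination. *)
have : norm (c *: v + y - w) <= Num.max (norm (a - w)) (norm r).
  have -> : c *: v + y - w = (a - w) - r.
    by rewrite /r !opprB [in RHS]addrC !addrA subrK [y + _]addrC.
  by rewrite -(normN r); exact: normD (normP S) _ _.
rewrite le_max => /orP[|h].
  by rewrite leNgt (le_lt_trans wv big).
exact: le_trans (ltW (le_lt_trans wv big)) h.
Qed.

(** The oracle minimizes over [Z_p]-combinations only; [attains_distance] turns its answer into a
    minimum over all [Q_p]-combinations. *)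
Lemma attains_reduced l beta a w : attains_distance l beta -> lattice l a ->
  lattice beta w ->
  (forall w', lattice beta w' -> norm (a - w) <= norm (a - w')) ->
  reduced beta (a - w).
Proof.
move=> al la /latticeP[x [_ wE]] wmin z.
have [w' [bw' w'z]] := al a la (fun i => x i + z i).
apply: le_trans (wmin _ bw') _; rewrite (le_trans w'z) //.
by rewrite -combD -wE opprD addrA.
Qed.

(** Modulo [beta], the subtracted vector [a] is the difference of the vectors [u] before and [p]
    after the subtraction. *)
Lemma within_sub beta a u p w (r : R) : lattice beta w -> p = u - a - w ->
  norm u <= r -> norm p <= r -> within beta r a.
Proof.
move=> bw pE ur pr; exists (- w); split; first exact: latticeN.
suff -> : a - - w = u - p by exact: normB_le.
by rewrite pE opprK !opprB [RHS]addrC !addrA subrK addrC.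
Qed.

(* If u - a is shorter than u modulo beta, then a is as long as u, so that
   subtracting a a second time cannot shorten u any more. *)
Lemma reduced_sub_twice beta a u p1 p2 w1 w2 : reduced beta u ->
  lattice beta w1 -> lattice beta w2 ->
  p1 = u - a - w1 -> p2 = p1 - a - w2 -> norm p1 < norm u ->
  norm u <= norm p2.
Proof.
move=> ru /latticeP[z1 [_ e1]] /latticeP[z2 [_ e2]] p1E p2E p1u.
have aE : a = p1 - p2 - w2.
  by rewrite p2E !opprB [w2 + _]addrC !addrA addrK addrAC subrr add0r.
have : norm u <= norm (p1 + (p1 - p2)).
  have -> : p1 + (p1 - p2) = u - comb (fun i => z1 i - z2 i) beta; last exact: ru.
  rewrite -combD -combN -e1 -e2.
  have -> : u = p1 + a + w1 by rewrite p1E addrAC !subrK.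
  by rewrite opprB [w2 - _]addrC [RHS]addrA addrK aE -addrA subrK.
case: (lerP (norm u) (norm p2)) => // p2u.
rewrite leNgt; case/negP; rewrite (le_lt_trans (normD (normP S) _ _)) //.
rewrite gt_max p1u (le_lt_trans (normD (normP S) _ _)) //.
by rewrite normN gt_max p1u.
Qed.

Lemma lattice_replace b beta p w : lattice (b ++ beta) w ->
  lattice (b ++ (p - w) :: beta) = lattice (b ++ p :: beta).
Proof.
move=> lw; apply: eq_lattice => v; rewrite mem_cat inE => /or3P[vb|/eqP->|vb].
1,3,4,6: by apply: lattice_mem; rewrite mem_cat inE vb ?orbT.
- apply: latticeB; first by apply: lattice_mem; rewrite mem_cat mem_head orbT.
  apply: lattice_sub lw => x; rewrite mem_cat => /orP[] xb;
  by apply: lattice_mem; rewrite mem_cat inE xb ?orbT.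
- rewrite -[p in lattice _ p](subrK w); apply: latticeD.
    by apply: lattice_mem; rewrite mem_cat mem_head orbT.
  apply: lattice_sub lw => x; rewrite mem_cat => /orP[] xb;
  by apply: lattice_mem; rewrite mem_cat inE xb ?orbT.
Qed.

End SuccessiveMaxima.

(** * The orthogonalization program *)

(** The orthogonal family grows downwards from the last slot. Thus the slots from register 2 on
    already form an oracle instance, the target followed by [beta]; the answer goes to the first
    free slot. *)
Definition CReduce : cmd :=
  CSeq (COracle (ISub (IVar 1) (IVar 2)) (IMul (IVar 2) (IVar 0))
                (IMul (IVar 1) (IVar 0)))
       (CSubBlock 4 (IMul (IVar 2) (IVar 0)) (IMul (IVar 1) (IVar 0))).

Definition CSubReduce : cmd :=
  CSeq (CSubBlock 4 (IMul (IVar 2) (IVar 0)) (IMul (IVar 3) (IVar 0))) CReduce.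

(* The vectors after position q (register 2) are orthogonal; the one at q
   becomes as long as possible modulo them. *)
Definition COrthogonalize : cmd :=
  CFor 5 (IVar 1)
    (CSeq (CIndex 2 (ISub (IVar 1) (IAdd (IVar 5) (ICst 1))))
    (CSeq CReduce
    (CFor 3 (IVar 2)
       (CSeq (CNorm 0 (IMul (IVar 2) (IVar 0)))
       (CSeq CSubReduce
       (CSeq (CNorm 1 (IMul (IVar 2) (IVar 0)))
             (CIf (TRealLe 0 1) CSkip CSubReduce))))))).

Section OrthogonalizationProgram.
Variables (R : realType) (S : normed_space R).
Variables (norm_cost : S -> nat) (oracle : seq S -> seq S) (b : nat).
Hypothesis norm_cost_leq : forall v, norm_cost v <= b.
Hypothesis dim_leq : dimS S <= b.
Hypothesis b_gt0 : 0 < b.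
Hypothesis oracleP : solves (closest_vector R) oracle.
Variable a : seq S.
Hypothesis free_a : free a.
Hypothesis size_leq : size a <= b.
Local Notation wp := (wp norm_cost oracle b).
Local Notation n := (dimS S).

Definition stores (s : state S) (vs : seq S) : Prop :=
  [/\ idx s 0 = n, idx s 1 = size vs &
      forall j, j < size vs -> read_vec (mem s) (j * n) = (vs`_j)%R].

Lemma stores_update s s' b1 p p' beta :
  stores s (b1 ++ p :: beta) ->
  (forall x, x != 4 -> idx s' x = idx s x) ->
  read_vec (mem s') (size b1 * n) = p' ->
  (forall j, j < size (b1 ++ p :: beta) -> j != size b1 ->
     read_vec (mem s') (j * n) = read_vec (mem s) (j * n)) ->
  stores s' (b1 ++ p' :: beta).
Proof.
move=> [s0 s1 sj] hi hp hm; split; first by rewrite hi.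
  by rewrite hi // s1 !size_cat.
move=> j; rewrite size_cat -(size_cat b1 (p :: beta)) => jb.
have [->|jb1] := eqVneq j (size b1); first by rewrite nth_cat ltnn subnn.
rewrite hm // sj // !nth_cat; case: ltnP => // b1j.
case E: (j - size b1) => [|k] //.
by move: jb1; rewrite eqn_leq b1j andbT -subn_eq0 E.
Qed.

Lemma wp_reduce b1 p beta s (Q : state S -> Prop) :
  stores s (b1 ++ p :: beta) -> idx s 2 = size b1 ->
  lattice (b1 ++ p :: beta) = lattice a -> size (b1 ++ p :: beta) = size a ->
  attains_distance a beta ->
  (forall s' w, lattice beta w -> reduced beta (p - w)%R ->
     stores s' (b1 ++ (p - w)%R :: beta) ->
     lattice (b1 ++ (p - w)%R :: beta) = lattice a ->
     (forall x, x != 4 -> idx s' x = idx s x) -> rreg s' = rreg s -> Q s') ->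
  wp CReduce s Q.
Proof.
move=> st s2 lat sza att hQ; have [s0 s1 sj] := st.
have szE : size (b1 ++ p :: beta) = size b1 + (size beta).+1 by rewrite size_cat.
have qE : read_vecs (mem s) (ieval (idx s) (ISub (IVar 1) (IVar 2)))
    (ieval (idx s) (IMul (IVar 2) (IVar 0))) = p :: beta.
  rewrite /= s0 s1 s2; apply: eq_read_vecs => [|j jk].
    by rewrite szE addKn.
  by rewrite -mulnDl sj ?nth_cat ?ltnNge ?leq_addr ?addKn // szE; lia.
(* Equal lattices have equal spans, and a spanning family with as many vectors as the free family
   [a] is free. *)
have free_b : free (b1 ++ p :: beta).
  by apply: free_size_span free_a; [exact: eq_lattice_span|].
have fbeta : free beta by move: free_b => /catr_free; rewrite free_cons => /andP[].
have := oracleP (x := p :: beta) (ex_intro _ p (ex_intro _ beta (conj erefl fbeta))).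
move=> [_ [_ [w [[<- <-] oE lw wmin]]]].
apply/wp_seq/wp_oracle; rewrite ?qE ?oE //.
  by rewrite /= s1 s2 (leq_trans (leq_subr _ _)) // sza.
have -> : ieval (idx s) (IMul (IVar 1) (IVar 0)) = size (b1 ++ p :: beta) * n.
  by rewrite /= s0 s1.
set s' := set_mem _ _ _.
have out j : j < size (b1 ++ p :: beta) ->
    read_vec (mem s') (j * n) = read_vec (mem s) (j * n).
  move=> jb; apply: eq_read_vec => l ln; rewrite /s' /= write_out //.
  by apply/orP; left; nia.
apply: (@wp_sub_block _ _ _ _ _ dim_leq _ _ _ _ (size b1 * n)
   (size (b1 ++ p :: beta) * n)) => //.
- by move=> f hf /=; rewrite !hf //= s0 s1 s2.
- by apply/orP; left; rewrite szE; nia.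
move=> s2' hi hr; rewrite out; last by rewrite szE; lia.
rewrite sj; last by rewrite szE; lia.
rewrite nth_cat ltnn subnn /= /s' /=.
have := @read_vec_write _ _ (mem s) (size (b1 ++ p :: beta) * n) [:: w] 0 isT.
rewrite mul0n addn0 => -> /= pE hm.
apply: (hQ _ w) => //.
- apply: (attains_reduced att _ lw wmin).
  by rewrite -lat; apply: lattice_mem; rewrite mem_cat mem_head orbT.
- apply: (stores_update st) => // j jb jb1; rewrite -out //.
  by apply: eq_read_vec => l ln; rewrite hm //; nia.
- rewrite lattice_replace //; apply: lattice_sub lw => x xb.
  by apply: lattice_mem; rewrite mem_cat xb orbT.
Qed.

Lemma wp_sub_reduce b1 p beta i s (Q : state S -> Prop) :
  stores s (b1 ++ p :: beta) -> idx s 2 = size b1 -> idx s 3 = i ->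
  i < size b1 ->
  lattice (b1 ++ p :: beta) = lattice a -> size (b1 ++ p :: beta) = size a ->
  attains_distance a beta ->
  (forall s' w, lattice beta w -> reduced beta (p - b1`_i - w)%R ->
     stores s' (b1 ++ (p - b1`_i - w)%R :: beta) ->
     lattice (b1 ++ (p - b1`_i - w)%R :: beta) = lattice a ->
     (forall x, x != 4 -> idx s' x = idx s x) -> rreg s' = rreg s -> Q s') ->
  wp CSubReduce s Q.
Proof.
move=> st s2 s3 ib lat sza att hQ; have [s0 s1 sj] := st.
have szE : size (b1 ++ p :: beta) = size b1 + (size beta).+1 by rewrite size_cat.
apply/wp_seq/(@wp_sub_block _ _ _ _ _ dim_leq _ _ _ _ (size b1 * n) (i * n)) => //.
- by move=> f hf /=; rewrite !hf //= s0 s2 s3.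
- by apply/orP; right; nia.
move=> s' hi hr; rewrite !sj; try by rewrite szE; lia.
rewrite !nth_cat ltnn subnn ib /= => pE hm.
apply: (@wp_reduce b1 (p - b1`_i)%R beta) => //.
- apply: (stores_update st) => // j jb jb1.
  by apply: eq_read_vec => l ln; rewrite hm //; nia.
- by rewrite hi.
- rewrite lattice_replace // ; apply: lattice_mem.
  by rewrite mem_cat mem_nth.
- by rewrite -sza !size_cat.
- move=> s4 w bw rw sw lw hi' hr'; apply: (hQ _ w) => //; last by rewrite hr'.
  by move=> x x4; rewrite hi' // hi.
Qed.

Lemma within_mono (beta : seq S) (r r' : R) v :
  (r <= r')%R -> within beta r v -> within beta r' v.
Proof. by move=> rr [w [bw wr]]; exists w; split=> //; exact: le_trans rr. Qed.

Lemma wp_orthogonalize s : stores s a ->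
  wp COrthogonalize s (fun s' => exists b' : seq S,
    [/\ stores s' b', size b' = size a, lattice b' = lattice a &
        orthogonal b']).
Proof.
move=> sa; have [sa0 sa1 _] := sa.
apply: (@wp_for _ _ _ _ _ _ _ _ _ (size a) (fun i s' => exists b1 beta,
  [/\ size beta = i, stores s' (b1 ++ beta),
      lattice (b1 ++ beta) = lattice a, size (b1 ++ beta) = size a &
      orthogonal beta /\ attains_distance a beta])) => //.
- by move=> i s' [b1 [beta [_ [_ /= -> _] _ -> _]]].
- exists a, [::]; rewrite cats0; split => //.
  by split; [exact: orthogonal_nil|exact: attains_distance_nil].
- move=> i s1 im s5 [b0 [beta [szb st lat sza [ob att]]]].
  have : size b0 = size a - i by rewrite -sza size_cat szb addnK.
  have := im; rewrite -subn_gt0.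
  case/lastP: b0 st lat sza => [_ _ _ /=|b1 p]; first by case: (size a - i).
  rewrite cat_rcons size_rcons => st lat sza _ szb1.
  have [s10 s11 s1j] := st.
  have qE : size a - (i + 1) = size b1 by lia.
  apply/wp_seq/wp_index; rewrite /= s11 s5 sza qE; first by lia.
  set s2 := set_idx _ _ _.
  apply/wp_seq/(@wp_reduce b1 p beta) => // s3 w bw rw st3 lat3 hi3 _.
  (* The norm of [p'] never decreases, so the bounds for vectors already treated survive every later
     change. *)
  apply: (@wp_for _ _ _ _ _ _ _ _ _ (size b1) (fun i' s' => exists p',
    [/\ stores s' (b1 ++ p' :: beta), lattice (b1 ++ p' :: beta) = lattice a,
        idx s' 5 = i, idx s' 2 = size b1 & reduced beta p' /\
        forall j, j < i' -> within beta (norm p') (b1`_j)%R])).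
  + lia.
  + by move=> i' s' [p' [_ _ _ /= ->]].
  + exists (p - w)%R; split => //=; rewrite ?hi3 //=.
  + move=> j s4 jb s43 [p1 [st4 lat4 s45 s42 [rp1 wi]]].
    have sz1 q : size (b1 ++ q :: beta) = size a by rewrite -sza !size_cat.
    have [s40 s41 s4j] := st4.
    have p1E q sq : stores sq (b1 ++ q :: beta) ->
        read_vec (mem sq) (size b1 * n) = q.
      move=> [_ _ ->]; first by rewrite nth_cat ltnn subnn.
      by rewrite size_cat /= addnS ltnS leq_addr.
    apply/wp_seq/wp_norm => //; rewrite /= s40 s42 (p1E p1) //.
    apply/wp_seq/(@wp_sub_reduce b1 p1 beta j) => //.
    move=> s5' w1 bw1; set p2 := (p1 - _ - _)%R => rp2 st5 lat5 hi5 hr5.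
    apply/wp_seq/wp_norm => //; rewrite /= !hi5 //= s40 s42 (p1E p2) //.
    apply: wp_if; rewrite /= hr5 /= => le12.
      apply: wp_skip; rewrite /= hi5 //=; split => //.
      exists p2; split => //=; rewrite ?hi5 //=; split => // j'.
      rewrite ltnS leq_eqVlt => /orP[/eqP ->|/wi]; last exact: within_mono.
      exact: within_sub bw1 erefl le12 (lexx _).
    apply: (@wp_sub_reduce b1 p2 beta j); rewrite /= ?hi5 //.
    move=> s6 w2 bw2; set p3 := (p2 - _ - _)%R => rp3 st6 lat6 hi6 hr6.
    rewrite -ltNge in le12.
    have le13 := reduced_sub_twice rp1 bw1 bw2 erefl erefl le12.
    rewrite /= hi6 //= hi5 //=; split => //.
    exists p3; split => //=; rewrite ?hi6 //= ?hi5 //=; split => // j'.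
    rewrite ltnS leq_eqVlt => /orP[/eqP ->|/wi]; last exact: within_mono.
    exact: within_sub bw2 erefl (ltW (lt_le_trans le12 le13)) (lexx _).
  + move=> s4 _ [p' [st4 lat4 s45 _ [rp wi]]]; split => //.
    exists b1, (p' :: beta); split => //=; first by rewrite szb.
      by rewrite -sza !size_cat.
    have sz1 : size (b1 ++ p' :: beta) = size a by rewrite -sza !size_cat.
    have free_b : free (b1 ++ p' :: beta).
      by apply: free_size_span free_a; [exact: eq_lattice_span|].
    split; first exact: orthogonal_cons.
    apply: attains_distance_cons => //.
    * by rewrite -lat4; apply: lattice_mem; rewrite mem_cat mem_head orbT.
    * by apply: free_not0 free_b _; rewrite mem_cat mem_head orbT.
    have closed0 v : lattice beta v -> within beta (norm p') v.
      by exists v; rewrite subrr norm0 norm_nneg.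
    (* By the ultrametric inequality the vectors within a given distance of the lattice of [beta]
       form a [Z_p]-module, so generators suffice. Those from [beta] are at distance 0, and [p'] is
       bounded by its own norm. *)
    rewrite -lat4; apply: lattice_ind.
    * exact/closed0/lattice0.
    * move=> u v [w1 [? ?]] [w2 [? ?]]; exists (w1 + w2)%R.
      by rewrite opprD addrACA; split; [exact: latticeD|exact: normD_le].
    * move=> c v c1 [w1 [? ?]]; exists (c *: w1)%R.
      by rewrite -scalerBr; split; [exact: latticeZ|exact: normZ_le].
    * move=> v; rewrite mem_cat inE => /or3P[vb|/eqP->|vb].
      - by rewrite -(nth_index 0%R vb); apply: wi; rewrite index_mem.
      - by exists 0%R; rewrite subr0; split; first exact: lattice0.
      - exact/closed0/lattice_mem.
- move=> s1 _ [b1 [beta [szb st lat sza [ob _]]]].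
  have b1E : b1 = [::].
    by apply: size0nil; move: sza; rewrite size_cat szb; lia.
  by exists beta; move: st lat sza; rewrite b1E.
Qed.

End OrthogonalizationProgram.

Lemma init_stores (R : realType) (S : normed_space R) (vs : seq S) :
  stores (init vs) vs.
Proof. by split => // j; exact: read_vec_init. Qed.

Lemma output_stores (R : realType) (S : normed_space R) (s : state S) vs :
  stores s vs -> output s = vs.
Proof. by move=> [_ s1 sj]; rewrite /output s1; exact: eq_read_vecs. Qed.

(** * Gauss-Jordan elimination *)

Section CoordinateChange.
Variables (R : realType) (S : normed_space R).
Local Notation K := (scalars S).
Local Notation n := (dimS S).
Local Open Scope ring_scope.
Implicit Types (f u : nat -> S) (X Y z : nat -> K).

Definition lin m (z : nat -> K) (f : nat -> S) : S := \sum_(i < m) z i *: f i.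

Definition indep m (f : nat -> S) : Prop :=
  forall z, lin m z f = 0 -> forall i, (i < m)%N -> z i = 0.

Lemma combE z (b : seq S) : comb z b = lin (size b) z (nth 0 b).
Proof. by []. Qed.

Lemma eq_lin m z z' f : (forall i, (i < m)%N -> z i = z' i) ->
  lin m z f = lin m z' f.
Proof. by move=> h; apply: eq_bigr => i _; rewrite h. Qed.

Lemma linB m z z' f : lin m z f - lin m z' f = lin m (fun i => z i - z' i) f.
Proof. by rewrite /lin -sumrB; apply: eq_bigr => i _; rewrite scalerBl. Qed.

Lemma indep_inj m f z z' : indep m f -> lin m z f = lin m z' f ->
  forall i, (i < m)%N -> z i = z' i.
Proof.
move=> ind /eqP; rewrite -subr_eq0 linB => /eqP /ind h i im.
by apply/eqP; rewrite -subr_eq0 h.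
Qed.

Lemma free_indep (b : seq S) : free b -> indep (size b) (nth 0 b).
Proof.
move=> fb z z0; apply: (comb_inj fb (z' := fun=> 0)); rewrite combE z0.
by rewrite /comb big1 // => i _; rewrite scale0r.
Qed.

Lemma lin_short m m' z f : (m <= m')%N ->
  (forall i, (m <= i < m')%N -> z i = 0) -> lin m' z f = lin m z f.
Proof.
move=> mm z0; rewrite -{1}(subnKC mm) /lin big_split_ord /= [X in _ + X]big1.
  by rewrite addr0.
move=> i _; rewrite z0 ?scale0r // leq_addr /=.
by have := ltn_ord i; rewrite ltn_subRL.
Qed.

Definition add_coord e l (X : nat -> K) : nat -> K :=
  fun i => if i == e then X e + X l else X i.

(** Adding coordinate [l] to coordinate [e] is compensated by subtracting [f e] from [f l], which
    leaves the vector itself unchanged. *)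
Definition add_frame e l (f : nat -> S) : nat -> S :=
  fun i => if i == l then f l - f e else f i.

Lemma lin_add m e l X f : (e < m)%N -> (l < m)%N -> e != l ->
  lin m (add_coord e l X) (add_frame e l f) = lin m X f.
Proof.
move=> em lm el; have le : Ordinal lm != Ordinal em by rewrite eq_sym.
rewrite /lin (bigD1 (Ordinal em)) // (bigD1 (Ordinal lm)) //=.
rewrite [RHS](bigD1 (Ordinal em)) // [in RHS](bigD1 (Ordinal lm)) //=.
rewrite /add_coord /add_frame !eqxx [l == e]eq_sym (negPf el).
rewrite [in LHS](eq_bigr (fun i : 'I_m => X i *: f i)) => [|i /andP[ie il]].
  rewrite !addrA; congr (_ + _); rewrite scalerDl scalerBr -!addrA.
  by congr (_ + _); rewrite addrC subrK.
by rewrite -!val_eqE /= in ie il; rewrite (negPf ie) (negPf il).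
Qed.

Lemma indep_add m e l f : (e < m)%N -> (l < m)%N -> e != l ->
  indep m f -> indep m (add_frame e l f).
Proof.
move=> em lm el ind z.
(* The preimage of [z] under the coordinate change, so that a relation in the new frame becomes one
   in the old frame. *)
pose X i := if i == e then z e - z l else z i.
have XE : add_coord e l X =1 z.
  move=> i; rewrite /add_coord /X eqxx [l == e]eq_sym (negPf el) subrK.
  by case: eqP => // ->.
rewrite (eq_lin (z' := add_coord e l X)) => [|i _]; last by rewrite XE.
rewrite lin_add // => /ind X0 i im; rewrite -XE /add_coord !X0 // addr0.
by case: ifP.
Qed.

(** The Steinitz exchange, where the vector with coordinates [Y] takes the place of the [e]-th frame
    vector. At [e] the first two terms cancel and the last one is the new coordinate; the program
    works in this same order. *)
Definition pivot_coord e (Y X : nat -> K) : nat -> K :=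
  fun i => X i - X e / Y e * Y i + (if i == e then X e / Y e else 0).

Definition pivot_frame m e (Y : nat -> K) (f : nat -> S) : nat -> S :=
  fun i => if i == e then lin m Y f else f i.

Lemma lin_pivot m e Y X f : (e < m)%N -> Y e != 0 ->
  lin m (pivot_coord e Y X) (pivot_frame m e Y f) = lin m X f.
Proof.
move=> em Ye; set y := X e / Y e.
have yE : y * Y e = X e by rewrite divfK.
rewrite /lin (bigD1 (Ordinal em)) // [RHS](bigD1 (Ordinal em)) //=.
rewrite {1}/pivot_coord {1}/pivot_frame !eqxx -/y yE subrr add0r.
rewrite (eq_bigr (fun i : 'I_m => (X i - y * Y i) *: f i)) => [|i ie]; last first.
  rewrite /pivot_coord /pivot_frame -/y.
  by rewrite -val_eqE /= in ie; rewrite (negPf ie) addr0.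
rewrite (eq_bigr (fun i : 'I_m => X i *: f i - y *: (Y i *: f i))) => [|i _];
  last by rewrite scalerBl scalerA.
rewrite sumrB -scaler_sumr /lin (bigD1 (Ordinal em)) //= scalerDr scalerA yE.
by rewrite -addrA; congr (_ + _); rewrite addrC subrK.
Qed.

Lemma indep_pivot m e Y f : (e < m)%N -> Y e != 0 ->
  indep m f -> indep m (pivot_frame m e Y f).
Proof.
move=> em Ye ind z.
pose X i := if i == e then Y e * z e else z i + z e * Y i.
have XE : pivot_coord e Y X =1 z.
  move=> i; rewrite /pivot_coord /X eqxx [Y e * z e]mulrC mulfK //.
  by case: eqP => [->|_]; rewrite ?subrr ?add0r // addrK addr0.
rewrite (eq_lin (z' := pivot_coord e Y X)) => [|i _]; last by rewrite XE.
rewrite lin_pivot // => /ind X0 i im; rewrite -XE /pivot_coord !X0 //.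
by rewrite !mul0r subrr add0r; case: ifP.
Qed.

Lemma frame_indep : indep n (nth 0 (frame S)).
Proof.
move=> z z0 i im; have fr := basis_free (frameP S).
have /freeP/(_ (fun j => z j))/(_ z0)/(_ (Ordinal im)) := fr.
by [].
Qed.

End CoordinateChange.

(* Memory map, with n = dim V in register 0 and m input vectors: the vectors in
   use occupy slots 0 .. 2m-1 (of n cells), a working copy of them the slots
   2m .. 4m-1, followed by two areas of 2m cells for temporary columns, one
   cell for a scalar and n cells for a scaled vector. *)
Definition EWork : iexp := IMul (IMul (ICst 2) (IVar 1)) (IVar 0).
Definition ECell (j l : iexp) : iexp := IAdd (IAdd EWork (IMul j (IVar 0))) l.
Definition EQuot (j : iexp) : iexp := IAdd (IMul (ICst 2) EWork) j.
Definition EProd (j : iexp) : iexp :=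
  IAdd (IAdd (IMul (ICst 2) EWork) (IMul (ICst 2) (IVar 1))) j.
Definition EScalar : iexp :=
  IAdd (IMul (ICst 2) EWork) (IMul (ICst 4) (IVar 1)).
Definition EScaled (l : iexp) : iexp := IAdd (IAdd EScalar (ICst 1)) l.

Definition CColumns (o : scalar_op) (d a c : iexp) : cmd :=
  CFor 7 (IVar 4) (COp o d a c).

(* Registers 2, 3, 4 hold the slot of the first pivot vector, the number of
   pivot vectors and the number of all vectors. *)
Definition CEliminate : cmd :=
  let pivot := IAdd (IVar 2) (IVar 5) in
  CFor 5 (IVar 3)
    (CSeq
      (CFor 6 (ISub (IVar 0) (IAdd (IVar 5) (ICst 1)))
        (CIf (TScalar0 (ECell pivot (IVar 5)))
          (CColumns OpAdd (ECell (IVar 7) (IVar 5)) (ECell (IVar 7) (IVar 5))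
            (ECell (IVar 7) (IAdd (IAdd (IVar 5) (ICst 1)) (IVar 6))))
          CSkip))
    (CSeq
      (CColumns OpDiv (EQuot (IVar 7)) (ECell (IVar 7) (IVar 5))
        (ECell pivot (IVar 5)))
    (CSeq
      (CFor 6 (IVar 0)
        (CSeq
          (CColumns OpMul (EProd (IVar 7)) (EQuot (IVar 7))
             (ECell pivot (IVar 6)))
          (CColumns OpSub (ECell (IVar 7) (IVar 6)) (ECell (IVar 7) (IVar 6))
             (EProd (IVar 7)))))
      (CColumns OpAdd (ECell (IVar 7) (IVar 5)) (ECell (IVar 7) (IVar 5))
         (EQuot (IVar 7)))))).

(** The machine cannot move scalars, so a copy is a multiplication by the 1 kept in the scalar
    cell. *)
Definition CCopyEliminate : cmd :=
  CSeq (CFor 7 (IMul (IVar 4) (IVar 0))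
          (COp OpMul (IAdd EWork (IVar 7)) (IVar 7) EScalar))
       CEliminate.

Section Elimination.
Variables (R : realType) (S : normed_space R).
Variables (norm_cost : S -> nat) (oracle : seq S -> seq S) (b : nat).
Local Notation K := (scalars S).
Local Notation n := (dimS S).
Local Notation wp := (wp norm_cost oracle b).
Variables (m off k N : nat).
Hypotheses (n_leq : n <= b) (N_leq : N <= b).
Hypotheses (k_leq_n : k <= n) (off_leq : off + k <= N) (N_leq_m : N <= 2 * m).

Definition cell (j l : nat) : nat := 2 * m * n + j * n + l.
Definition quot (j : nat) : nat := 2 * (2 * m * n) + j.
Definition prod_cell (j : nat) : nat := 2 * (2 * m * n) + 2 * m + j.
Definition scalar_cell : nat := 2 * (2 * m * n) + 4 * m.

Lemma cell_inj j l j' l' : l < n -> l' < n -> cell j l = cell j' l' ->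
  j = j' /\ l = l'.
Proof.
rewrite /cell => ln l'n /eqP; rewrite -!addnA eqn_add2l => /eqP E.
have n0 : 0 < n by lia.
split; first by have := congr1 (divn^~ n) E; rewrite !divnMDl // !divn_small ?addn0.
by have := congr1 (modn^~ n) E; rewrite !modnMDl !modn_small.
Qed.

Lemma cell_neq j l j' l' : l < n -> l' < n -> (j, l) != (j', l') ->
  cell j l != cell j' l'.
Proof.
move=> ln l'n; apply: contra => /eqP /(cell_inj ln l'n) [-> ->]; exact: eqxx.
Qed.

Lemma cell_lt j l : j < N -> l < n -> 2 * m * n <= cell j l < 2 * (2 * m * n).
Proof. by rewrite /cell => jN ln; apply/andP; split; nia. Qed.

Definition env (f : nat -> nat) : Prop :=
  [/\ f 0 = n, f 1 = m, f 2 = off, f 3 = k & f 4 = N].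

(** The memory that may change is exactly the working copy and the two temporary columns; the
    vectors in use and the stored scalar survive. *)
Definition keeps (rs : seq nat) (s s' : state S) : Prop :=
  (forall x, x \notin rs -> idx s' x = idx s x) /\
  (forall x, (x < 2 * m * n) || (scalar_cell <= x) -> mem s' x = mem s x).

Lemma keeps_trans rs s1 s2 s3 : keeps rs s1 s2 -> keeps rs s2 s3 ->
  keeps rs s1 s3.
Proof.
by move=> [h1 h2] [h3 h4]; split => x hx; [rewrite h3 ?h1|rewrite h4 ?h2].
Qed.

Lemma keeps_sub (rs rs' : seq nat) s s' : {subset rs <= rs'} ->
  keeps rs s s' -> keeps rs' s s'.
Proof.
by move=> sub [h1 h2]; split => // x xr; apply: h1; apply: contra xr; exact: sub.
Qed.

Lemma keeps_idx rs s s' x k0 : keeps rs s s' -> x \in rs ->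
  keeps rs s (set_idx s' x k0).
Proof.
move=> [h1 h2] xr; split => // y yr /=; rewrite ifN ?h1 //.
by apply: contraNneq yr => ->.
Qed.

Lemma keeps_env rs s s' : keeps rs s s' -> env (idx s) ->
  all (fun x => 4 < x) rs -> env (idx s').
Proof.
move=> [h _] [e0 e1 e2 e3 e4] /allP rs4.
by split; rewrite h //; apply/negP => /rs4.
Qed.

Lemma wp_columns o d a c s (D A C : nat -> nat) (Q : state S -> Prop) :
  env (idx s) ->
  (forall f j, (forall x, x != 7 -> f x = idx s x) -> f 7 = j -> env f ->
     [/\ ieval f d = D j, ieval f a = A j & ieval f c = C j]) ->
  (forall i j, i < j -> j < N -> [/\ D i != D j, D i != A j & D i != C j]) ->
  (forall j, j < N -> 2 * m * n <= D j < scalar_cell) ->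
  (forall s', keeps [:: 7] s s' ->
     (forall j, j < N -> mem s' (D j) = op_eval o (mem s (A j)) (mem s (C j))) ->
     (forall x, (forall j, j < N -> x != D j) -> mem s' x = mem s x) -> Q s') ->
  wp (CColumns o d a c) s Q.
Proof.
move=> es he hD hb hQ.
apply: (@wp_parallel _ _ _ _ _ _ _ _ _ _ _ _ N D A C) => //.
- move=> f i hf fi; have ef : env f.
    by case: es => [e0 e1 e2 e3 e4]; split; rewrite hf.
  by have [-> -> ->] := he f i hf fi ef; split => //=; case: ef.
- move=> s' hi hr hin hout; apply: hQ => //; split => x.
    by rewrite inE; exact: hi.
  move=> hx; apply: hout => j jN; have := hb j jN.
  by apply: contraTneq => <-; lia.
Qed.

Variable u : nat -> S.

(* Column operations on the coordinates are traded for a change of the frame f: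
   the vectors u_j never change, and f i becomes the i-th pivot vector. *)
Definition represents (s : state S) (f : nat -> S) : Prop :=
  forall j, j < N -> u j = lin n (fun l => mem s (cell j l)) f.

Definition fixes (e : nat) (f : nat -> S) : Prop :=
  forall i, i < e -> f i = u (off + i).

Hypothesis pivots_indep : indep k (fun i => u (off + i)).

(** Otherwise the [e]-th pivot vector would be a combination of the first [e] frame vectors, which
    are the earlier pivot vectors. *)
Lemma pivot_neq0 s f e : e < k -> represents s f -> fixes e f ->
  (forall i, e <= i < n -> mem s (cell (off + e) i) = 0%R) -> False.
Proof.
move=> ek rep fx z0.
have en : e < n by apply: leq_trans k_leq_n.
have uE : u (off + e) = lin e (fun l => mem s (cell (off + e) l)) f.
  by rewrite rep ?(lin_short (m := e)) //; lia.
pose z i := if i < e then mem s (cell (off + e) i) else (- (i == e)%:R)%R.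
have zE : lin e z (fun i => u (off + i)) = u (off + e).
  by rewrite uE; apply: eq_bigr => i _; rewrite /z ltn_ord fx.
have := pivots_indep (z := z); rewrite (lin_short (m := e.+1)) //; last first.
  by move=> i /andP[ei ik]; rewrite /z ltnNge ltnW // gtn_eqF // oppr0.
rewrite {1}/lin big_ord_recr /= -/(lin e z (fun i => u (off + i))) zE.
rewrite {1}/z ltnn eqxx scaleN1r subrr => /(_ erefl e ek) /eqP.
by rewrite /z ltnn eqxx oppr_eq0 oner_eq0.
Qed.

Lemma represents_eq s s' f g (phi : (nat -> K) -> nat -> K) :
  represents s f ->
  (forall X, lin n (phi X) g = lin n X f) ->
  (forall j l, j < N -> l < n ->
     mem s' (cell j l) = phi (fun i => mem s (cell j i)) l) ->
  represents s' g.
Proof.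
move=> rep hphi hm j jN; rewrite rep // -hphi; apply: eq_lin => l ln.
by rewrite hm.
Qed.

(** The frame is never stored; it exists only in the proof, as the meaning of the matrix columns. *)
Definition progress (e : nat) (s : state S) : Prop :=
  exists f, [/\ indep n f, represents s f & fixes e f].

(** Columns are added instead of swapped: while the pivot entry is 0, the first later column with a
    nonzero entry in that row makes it nonzero. Only frame vectors beyond [e] change, so the pivots
    already in place stay. *)
Lemma wp_find_pivot e s (Q : state S -> Prop) : e < k -> env (idx s) ->
  idx s 5 = e -> progress e s ->
  (forall s', keeps [:: 6; 7] s s' -> progress e s' ->
     mem s' (cell (off + e) e) != 0%R -> Q s') ->
  wp (CFor 6 (ISub (IVar 0) (IAdd (IVar 5) (ICst 1)))
        (CIf (TScalar0 (ECell (IAdd (IVar 2) (IVar 5)) (IVar 5)))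
          (CColumns OpAdd (ECell (IVar 7) (IVar 5)) (ECell (IVar 7) (IVar 5))
            (ECell (IVar 7) (IAdd (IAdd (IVar 5) (ICst 1)) (IVar 6))))
          CSkip)) s Q.
Proof.
move=> ek es s5 pr hQ; have en : e < n by apply: leq_trans k_leq_n.
apply: (@wp_for _ _ _ _ _ _ _ _ _ (n - (e + 1)) (fun l s' =>
  [/\ keeps [:: 6; 7] s s', progress e s' &
      mem s' (cell (off + e) e) != 0%R \/
      forall i, e <= i < e + 1 + l -> mem s' (cell (off + e) i) = 0%R])).
- lia.
- move=> l s' [ks _ _] /=; have [-> _ _ _ _] := keeps_env ks es isT.
  by rewrite ks.1 // s5.
- split; [exact: keeps_idx|exact: pr|].
  have [z0|] := eqVneq (mem s (cell (off + e) e)) 0%R; last by left.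
  right => i ie; have -> : i = e by lia.
  exact: z0.
- move=> l s1 ln s16 [ks pr1 piv]; have es1 := keeps_env ks es isT.
  have [s10 s11 s12 s13 s14] := es1.
  have s15 : idx s1 5 = e by rewrite ks.1.
  have pE : ieval (idx s1) (ECell (IAdd (IVar 2) (IVar 5)) (IVar 5)) =
      cell (off + e) e by rewrite /= s10 s11 s12 s15.
  apply: wp_if; rewrite /test_eval pE => pz; last first.
    apply: wp_skip; split => //; split => //; last by left.
    exact: keeps_idx.
  pose l' := e + 1 + l; have l'n : l' < n by rewrite /l'; lia.
  have el' : e != l' by rewrite /l'; lia.
  apply: (@wp_columns _ _ _ _ _ (fun j => cell j e) (fun j => cell j e)
     (fun j => cell j l')) => //.
  + move=> f j hf f7 [f0 f1 f2 f3 f4] /=; rewrite f0 f1 f7 !hf // s15 s16.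
    by rewrite /cell /l'.
  + move=> i j ij jN; split; apply: cell_neq => //; rewrite xpair_eqE; lia.
  + by move=> j jN; have := cell_lt jN en; rewrite /scalar_cell; lia.
  move=> s2 k2 hin hout; rewrite k2.1 // s16; split => //.
  have mE j i : j < N -> i < n -> mem s2 (cell j i) =
      add_coord e l' (fun i => mem s1 (cell j i)) i.
    move=> jN iN; rewrite /add_coord; case: eqP => [->|/eqP ie].
      by rewrite hin.
    by rewrite hout // => j' j'N; apply: cell_neq => //; rewrite xpair_eqE; lia.
  have pN : off + e < N by lia.
  split.
  + apply: keeps_idx => //; apply: keeps_trans ks _.
    by apply: keeps_sub k2 => x; rewrite !inE => ->; rewrite orbT.
  + have [f [ind rep fx]] := pr1; exists (add_frame e l' f); split.
    * exact: indep_add.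
    * by apply: represents_eq rep _ mE => X; rewrite lin_add.
    * by move=> i ie; rewrite /add_frame ifN ?fx //; rewrite /l'; lia.
  + rewrite /= !mE // /add_coord eqxx (eqP pz) add0r.
    have [lz|] := eqVneq (mem s1 (cell (off + e) l')) 0%R; last by left.
    right => i ie; rewrite mE //; last by lia.
    rewrite /add_coord; case: eqP => [_|_]; first by rewrite (eqP pz) lz addr0.
    have [->|il] := eqVneq i l'; first by [].
    case: piv => [|->]; [by rewrite pz|by []|].
    by move: il ie; rewrite /l'; lia.
- move=> s' _ [ks pr' piv]; apply: hQ => //; case: piv => // z0.
  case: pr' => f [_ rep fx]; case: (pivot_neq0 ek rep fx) => i ie.
  by apply: z0; lia.
Qed.

Lemma wp_clear_columns e s (Q : state S -> Prop) : e < k -> env (idx s) ->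
  idx s 5 = e ->
  (forall j, j < N -> mem s (quot j) =
     (mem s (cell j e) / mem s (cell (off + e) e))%R) ->
  mem s (cell (off + e) e) != 0%R ->
  (forall s', keeps [:: 6; 7] s s' ->
     (forall j, j < N -> mem s' (quot j) = mem s (quot j)) ->
     (forall j i, j < N -> i < n -> mem s' (cell j i) =
        (mem s (cell j i) - mem s (quot j) * mem s (cell (off + e) i))%R) ->
     Q s') ->
  wp (CFor 6 (IVar 0)
        (CSeq
          (CColumns OpMul (EProd (IVar 7)) (EQuot (IVar 7))
             (ECell (IAdd (IVar 2) (IVar 5)) (IVar 6)))
          (CColumns OpSub (ECell (IVar 7) (IVar 6)) (ECell (IVar 7) (IVar 6))
             (EProd (IVar 7))))) s Q.
Proof.
move=> ek es s5 hq pz hQ; have en : e < n by apply: leq_trans k_leq_n.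
have pN : off + e < N by lia.
apply: (@wp_for _ _ _ _ _ _ _ _ _ n (fun l s' =>
  [/\ keeps [:: 6; 7] s s',
      forall j, j < N -> mem s' (quot j) = mem s (quot j) &
      forall j i, j < N -> i < n -> mem s' (cell j i) =
        if i < l then
          (mem s (cell j i) - mem s (quot j) * mem s (cell (off + e) i))%R
        else mem s (cell j i)])).
- exact: n_leq.
- by move=> l s' [ks _ _] /=; have [-> _ _ _ _] := keeps_env ks es isT.
- by split => //; exact: keeps_idx.
- move=> l s1 ln s16 [ks hq1 hc1]; have es1 := keeps_env ks es isT.
  have s15 : idx s1 5 = e by rewrite ks.1.
  (* All products are computed before any subtraction, because the subtraction clears the entry of
     the pivot row, which the other rows still need. The quotients have their own column since
     column [e] is cleared too. *)
  apply/wp_seq/(@wp_columns _ _ _ _ _ prod_cell quot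
     (fun=> cell (off + e) l)) => //.
  + move=> f j hf f7 [f0 f1 f2 f3 f4] /=; rewrite f0 f1 f2 f7 !hf // s15 s16.
    by rewrite /cell /quot /prod_cell; split; lia.
  + move=> i j ij jN; have := cell_lt pN ln.
    by rewrite /prod_cell /quot; split; lia.
  + by move=> j jN; rewrite /prod_cell /scalar_cell; lia.
  move=> s2 k2 hin2 hout2; have es2 := keeps_env k2 es1 isT.
  have hc2 j i : j < N -> i < n -> mem s2 (cell j i) = mem s1 (cell j i).
    move=> jN iN; apply: hout2 => j' j'N; have := cell_lt jN iN.
    by rewrite /prod_cell; lia.
  have hq2 j : j < N -> mem s2 (quot j) = mem s1 (quot j).
    by move=> jN; apply: hout2 => j' j'N; rewrite /prod_cell /quot; lia.
  apply: (@wp_columns _ _ _ _ _ (fun j => cell j l) (fun j => cell j l)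
     prod_cell) => //.
  + move=> f j hf f7 [f0 f1 f2 f3 f4] /=; rewrite f0 f1 f7 !hf //.
    rewrite !k2.1 // s16 /cell /prod_cell; split; lia.
  + move=> i j ij jN; have := cell_lt (ltn_trans ij jN) ln.
    rewrite /prod_cell => ib; split; last by lia.
      by apply: cell_neq => //; rewrite xpair_eqE; lia.
    by apply: cell_neq => //; rewrite xpair_eqE; lia.
  + by move=> j jN; have := cell_lt jN ln; rewrite /scalar_cell; lia.
  move=> s3 k3 hin3 hout3; rewrite k3.1 // k2.1 // s16; split => //.
  have k23 : keeps [:: 6; 7] s1 s3.
    by apply: (@keeps_trans _ _ s2); [apply: keeps_sub k2|apply: keeps_sub k3]
      => x; rewrite !inE => ->; rewrite orbT.
  split.
  + by apply: keeps_idx => //; exact: keeps_trans k23.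
  + move=> j jN /=; rewrite hout3 ?hq2 ?hq1 // => j' j'N.
    by have := cell_lt j'N ln; rewrite /quot; lia.
  + move=> j i jN iN /=; have [->|il] := eqVneq i l.
      rewrite hin3 // leqnn /= hin2 // !hc2 // !hc1 // ltnn hq1 //.
    rewrite hout3 ?hc2 ?hc1 //; last first.
      by move=> j' j'N; apply: cell_neq => //; rewrite xpair_eqE; lia.
    by rewrite ltnS [i <= l]leq_eqVlt (negPf il).
- move=> s' _ [ks hq' hc']; apply: hQ => // j i jN iN.
  by rewrite hc' // iN.
Qed.

Lemma wp_eliminate s (Q : state S -> Prop) : env (idx s) -> progress 0 s ->
  (forall s', keeps [:: 5; 6; 7] s s' -> progress k s' -> Q s') ->
  wp CEliminate s Q.
Proof.
move=> es pr hQ; apply: (@wp_for _ _ _ _ _ _ _ _ _ k (fun e s' =>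
  keeps [:: 5; 6; 7] s s' /\ progress e s')).
- lia.
- by move=> e s' [ks _]; have [_ _ _ /= -> _] := keeps_env ks es isT.
- by split; first exact: keeps_idx.
- move=> e s1 ek s15 [ks1 pr1]; have en : e < n by apply: leq_trans k_leq_n.
  have pN : off + e < N by lia.
  have es1 := keeps_env ks1 es isT.
  apply/wp_seq/(wp_find_pivot (e := e)) => // s2 k12 pr2 pz.
  have es2 := keeps_env k12 es1 isT.
  have s25 : idx s2 5 = e by rewrite k12.1.
  apply/wp_seq/(@wp_columns _ _ _ _ _ quot (fun j => cell j e)
     (fun=> cell (off + e) e)) => //.
  + move=> f j hf f7 [f0 f1 f2 f3 f4] /=; rewrite f0 f1 f2 f7 !hf // s25.
    by rewrite /cell /quot; split; lia.
  + move=> i j ij jN; have := cell_lt pN en; have := cell_lt jN en.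
    by rewrite /quot; split; lia.
  + by move=> j jN; rewrite /quot /scalar_cell; lia.
  move=> s3 k23 hin3 hout3; have es3 := keeps_env k23 es2 isT.
  have hc3 j i : j < N -> i < n -> mem s3 (cell j i) = mem s2 (cell j i).
    move=> jN iN; apply: hout3 => j' j'N; have := cell_lt jN iN.
    by rewrite /quot; lia.
  apply/wp_seq/(@wp_clear_columns e) => //.
  + by rewrite k23.1.
  + by move=> j jN; rewrite hin3 // !hc3.
  + by rewrite hc3.
  move=> s4 k34 hq4 hc4; have es4 := keeps_env k34 es3 isT.
  apply: (@wp_columns _ _ _ _ _ (fun j => cell j e) (fun j => cell j e)
     quot) => //.
  + move=> f j hf f7 [f0 f1 f2 f3 f4] /=; rewrite f0 f1 f7 !hf //.
    by rewrite !k34.1 // k23.1 // s25 /cell /quot; split; lia.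
  + move=> i j ij jN; have := cell_lt (ltn_trans ij jN) en.
    rewrite /quot => ib; split; last by lia.
      by apply: cell_neq => //; rewrite xpair_eqE; lia.
    by apply: cell_neq => //; rewrite xpair_eqE; lia.
  + by move=> j jN; have := cell_lt jN en; rewrite /scalar_cell; lia.
  move=> s5 k45 hin5 hout5.
  rewrite k45.1 // k34.1 // k23.1 // s25; split => //; split.
    apply: keeps_idx => //; apply: keeps_trans ks1 _.
    have sub7 : {subset [:: 7] <= [:: 5; 6; 7]}
      by move=> x; rewrite !inE => ->; rewrite !orbT.
    have sub67 : {subset [:: 6; 7] <= [:: 5; 6; 7]}
      by move=> x; rewrite !inE => ->; rewrite !orbT.
    apply: keeps_trans (keeps_sub sub67 k12) _.
    apply: keeps_trans (keeps_sub sub7 k23) _.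
    exact: keeps_trans (keeps_sub sub67 k34) (keeps_sub sub7 k45).
  have [f [ind rep fx]] := pr2.
  pose Y i := mem s2 (cell (off + e) i).
  exists (pivot_frame n e Y f); split.
  + exact: indep_pivot.
  + apply: (represents_eq (s := s2) rep (phi := pivot_coord e Y)).
      by move=> X; rewrite lin_pivot.
    move=> j i jN iN /=; rewrite /pivot_coord.
    have c4 : mem s4 (cell j i) = (mem s2 (cell j i) -
        mem s2 (cell j e) / Y e * Y i)%R by rewrite hc4 // !hc3 // hin3.
    case: eqP => [ie|/eqP ie].
      by rewrite ie in c4 *; rewrite -c4 hin5 //= hq4 // hin3.
    rewrite addr0 -c4; apply: hout5 => j' j'N.
    by apply: cell_neq => //; rewrite xpair_eqE; lia.
  + move=> i; rewrite ltnS leq_eqVlt /pivot_frame => /orP[/eqP ->|ie].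
      by rewrite eqxx rep.
    by rewrite ltn_eqF // fx.
- by move=> s' _ [ks pr']; exact: hQ.
Qed.

End Elimination.

Section CopyElimination.
Variables (R : realType) (S : normed_space R).
Variables (norm_cost : S -> nat) (oracle : seq S -> seq S) (b : nat).
Local Notation n := (dimS S).
Local Notation wp := (wp norm_cost oracle b).
Variables (m off k N : nat).
Hypotheses (n_leq : n <= b) (N_leq : N <= b) (Nn_leq : N * n <= b).
Hypotheses (k_leq_n : k <= n) (off_leq : off + k <= N) (N_leq_m : N <= 2 * m).

Lemma wp_copy_eliminate s (Q : state S -> Prop) :
  let u j := read_vec (mem s) (j * n) in
  env S m off k N (idx s) -> mem s (scalar_cell S m) = 1%R ->
  indep k (fun i => u (off + i)) ->
  (forall s', keeps m [:: 5; 6; 7] s s' -> progress m off N u k s' -> Q s') ->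
  wp CCopyEliminate s Q.
Proof.
move=> u es sz ind hQ; have [s0 s1 s2 s3 s4] := es.
apply/wp_seq/(@wp_parallel _ _ _ _ _ _ _ _ _ _ _ _ (N * n)
  (fun x => 2 * m * n + x) id (fun=> scalar_cell S m)) => //.
- move=> f i hf fi /=; rewrite fi !hf // s0 s1 s4 /scalar_cell; split; lia.
- by move=> i j ij jN; rewrite /scalar_cell; split; nia.
move=> s' hi _ hin hout; have ks : keeps m [:: 7] s s'.
  split => x; first by rewrite inE; exact: hi.
  by move=> hx; apply: hout => j jN; move: hx; rewrite /scalar_cell; nia.
have es' := keeps_env ks es isT.
apply: (@wp_eliminate _ _ _ _ b m off k N _ _ _ _ _ u) => //.
  (* At the start the stored coordinates refer to the frame of [S], and no pivot vector is in place
     yet. *)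
  exists (nth 0%R (frame S)); split => //; first exact: frame_indep.
  move=> j jN; rewrite /u /read_vec /lin; apply: eq_bigr => l _.
  rewrite /cell -addnA hin /= ?sz ?mulr1 //.
  by have := ltn_ord l; rewrite -/(dimS S); nia.
move=> s5 k5 pr; apply: hQ => //; apply: keeps_trans k5.
by apply: keeps_sub ks => x; rewrite !inE => ->; rewrite !orbT.
Qed.

End CopyElimination.

(** * Closest vectors with an orthogonalization oracle *)

Section ClosestVector.
Variables (R : realType) (S : normed_space R).
Local Notation K := (scalars S).
Local Notation n := (dimS S).
Local Open Scope ring_scope.
Implicit Types (t u v w : S) (a b c : seq S) (x y z phi : nat -> K).

Definition closest a t v : Prop :=
  lattice a v /\ forall w, lattice a w -> norm (t - v) <= norm (t - w).

Lemma comb_sub_nth z (x : K) b i : (i < size b)%N ->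
  comb z b - x *: b`_i = comb (fun j => if j == i then z j - x else z j) b.
Proof.
move=> ib; rewrite (comb_delta ib) combZ combN combD; apply: eq_comb => j _.
by case: eqP => _; rewrite ?mulr1 // mulr0 subr0.
Qed.

(** Orthogonality treats each coordinate separately. An integral one is matched exactly; if [x i] is
    not integral, subtracting an integral scalar cannot make it smaller, so 0 is as good as any
    choice. *)
Lemma closest_round b x : orthogonal b ->
  closest b (comb x b)
    (comb (fun i => if absp (x i) <= 1 then x i else 0) b).
Proof.
move=> /orthogonalP ob; split.
  apply/latticeP; eexists; split; last by [].
  by move=> i _ /=; case: ifP => //; rewrite absp0.
move=> w /latticeP[z [z1 ->]]; rewrite !combN !combD !ob.
apply: bigmax_ler => [|i].
  by elim/big_ind: _ => // [? ? h _|j _]; rewrite ?le_max ?h // norm_nneg.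
apply: le_trans (ler_bigmax _ i) => /=; rewrite !normZr.
case: ifP => [_|/negbT].
  by rewrite subrr absp0 mul0r mulr_ge0 ?norm_nneg ?absp_nneg.
rewrite -ltNge subr0 => x1; rewrite ler_wpM2r ?norm_nneg //.
rewrite leNgt; apply/negP => h; move: (lexx (absp (x i))); rewrite leNgt.
case/negP; rewrite -{1}[x i](subrK (z i)).
apply: le_lt_trans (abspD (abspP S) _ _) _.
by rewrite gt_max h (le_lt_trans (z1 i _)).
Qed.

(** The frame [f] extends [t :: a], so by uniqueness of coordinates [X 0] is the integral
    coefficient of [t] in [v]. *)
Lemma lattice_cons_coord t a X (f : nat -> S) v : free (t :: a) ->
  (size (t :: a) <= n)%N -> indep n f ->
  (forall i, (i < size (t :: a))%N -> f i = (t :: a)`_i) ->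
  v = lin n X f -> lattice (t :: a) v ->
  absp (X 0%N) <= 1 /\ lattice a (v - X 0%N *: t).
Proof.
move=> fr sn ind fE vE /latticeP[z [z1 vz]].
have : lin n X f = lin n (fun i => if (i < size (t :: a))%N then z i else 0) f.
  rewrite -vE vz [RHS](lin_short (m := size (t :: a))) //.
    by apply: eq_bigr => i _; rewrite ltn_ord fE.
  by move=> i /andP[si _]; rewrite ltnNge si.
move=> /(indep_inj ind)/(_ 0%N) /= -> //; last exact: leq_trans sn.
split; first exact: z1.
rewrite vz comb_cons addrAC subrr add0r; apply/latticeP.
by exists (fun i => z i.+1); split => // i ia; apply: z1.
Qed.

(* Vectors t - w with w in the lattice of a are those with t-coordinate 1; in
   the basis c one of their coordinates and the t-coordinate of the basis
   vector must both be units. *)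
Lemma closest_unit t a c phi u (d : K) : free (t :: a) -> orthogonal c ->
  lattice c = lattice (t :: a) ->
  (forall i, (i < size c)%N ->
     absp (phi i) <= 1 /\ lattice a (c`_i - phi i *: t)) ->
  absp d = 1 -> lattice a (u - d *: t) ->
  (forall i, (i < size c)%N -> 1 <= absp (phi i) -> norm u <= norm c`_i) ->
  closest a t (t - d^-1 *: u).
Proof.
move=> fr /orthogonalP oc latc hphi d1 lu ubest.
have d0 : d != 0 by apply: contra_eq_neq d1 => ->; rewrite absp0 eq_sym oner_eq0.
split.
  have -> : t - d^-1 *: u = - (d^-1 *: (u - d *: t)).
    by rewrite scalerBr scalerA mulVf // scale1r opprB.
  by apply/latticeN/latticeZ => //; rewrite abspV // d1 invr1.
move=> w lw; rewrite opprB addrC subrK normZr abspV // d1 invr1 mul1r.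
have : lattice c (t - w).
  rewrite latc; apply: latticeB; first by apply: lattice_mem; rewrite mem_head.
  by apply: lattice_sub lw => v va; apply: lattice_mem; rewrite inE va orbT.
move=> /latticeP[y [y1 twE]].
have sumE : t - w = (\sum_(i < size c) y i * phi i) *: t +
    \sum_(i < size c) y i *: (c`_i - phi i *: t).
  rewrite twE scaler_suml -big_split; apply: eq_bigr => i _ /=.
  by rewrite scalerBr scalerA addrC subrK.
(* Both sides are the [t]-coordinate of [t - w]; if they differed, [t] would lie in the span of
   [a]. *)
have sum1 : \sum_(i < size c) y i * phi i = 1.
  move: fr; rewrite free_cons => /andP[ta _]; apply: contraNeq ta => ne.
  set s := \sum_(i < size c) y i * phi i in sumE ne.
  set l := \sum_(i < size c) _ in sumE.
  have la : l \in <<a>>%VS.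
    by apply: memv_suml => i _; apply/memvZ/lattice_span; have [] := hphi i (ltn_ord i).
  have : (1 - s) *: t \in <<a>>%VS.
    have -> : (1 - s) *: t = w + l.
      rewrite scalerBl scale1r -{1}[t](subrK w) sumE.
      rewrite addrC !addrA [_ + w]addrC -!addrA; congr (_ + _).
      by rewrite addrA [- _ + _]addrC subrr add0r.
    by rewrite memvD // lattice_span.
  move=> /(memvZ (1 - s)^-1).
  by rewrite scalerA mulVf ?scale1r // subr_eq0 eq_sym.
(* A sum of terms of absolute value below 1 stays below 1, hence cannot be 1. Both factors of the
   term found are integral, so each has absolute value at least 1. *)
have [i hi] : exists i : 'I_(size c), 1 <= absp (y i * phi i).
  apply/existsP; rewrite -[X in is_true X]negbK negb_exists; apply/negP => /forallP h.
  have : absp (\sum_(i < size c) y i * phi i) < 1.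
    apply: (big_ind (fun e : K => absp e < 1)) => [|e e' h1 h2|j _].
    - by rewrite absp0 ltr01.
    - by apply: le_lt_trans (abspD (abspP S) _ _) _; rewrite gt_max h1.
    - by rewrite ltNge h.
  by rewrite sum1 absp1 ltxx.
have [phi1 _] := hphi i (ltn_ord i).
rewrite abspMr in hi.
have phige : 1 <= absp (phi i).
  by apply: le_trans hi _; rewrite ler_piMl ?absp_nneg ?y1.
have yge : 1 <= absp (y i).
  by apply: le_trans hi _; rewrite ler_piMr ?absp_nneg.
rewrite twE oc; apply: le_trans (ler_bigmax _ i) => /=.
rewrite normZr (le_trans (ubest _ (ltn_ord i) phige)) //.
by rewrite ler_peMl ?norm_nneg.
Qed.

End ClosestVector.

(** * The closest vector program *)

(** The multiple is first written to a separate area, so that the subtraction from slot 0 is correct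
    even if the vector at [base] is in slot 0 itself. *)
Definition CSubScaled (base coef : iexp) : cmd :=
  CSeq (CFor 7 (IVar 0)
          (COp OpMul (EScaled (IVar 7)) (IAdd base (IVar 7)) coef))
       (CSubBlock 7 (ICst 0) (EScaled (ICst 0))).

(** The target turns into its closest vector in place: integral coordinates are left alone, the
    others are removed entirely. *)
Definition CRound : cmd :=
  CFor 8 (IVar 3)
    (CSeq (CAbs 1 (ECell (ICst 0) (IVar 8)))
          (CIf (TRealLe 1 0) CSkip
             (CSubScaled (IMul (IAdd (IVar 1) (IVar 8)) (IVar 0))
                (ECell (ICst 0) (IVar 8))))).

(** All [2 * m] stored vectors compete, [t] and [a] included: they lie in the same lattice, and more
    competitors can only give a shorter winner. As [t]-coordinates are integral there, comparing
    with 1 from below detects units. *)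
Definition CSelect : cmd :=
  CFor 8 (IVar 4)
    (CSeq (CAbs 1 (ECell (IVar 8) (ICst 0)))
          (CIf (TRealLe 0 1)
             (CSeq (CNorm 1 (IMul (IVar 8) (IVar 0)))
             (CSeq (CNorm 2 (IMul (IVar 9) (IVar 0)))
                   (CIf (TRealLe 1 2) (CIndex 9 (IVar 8)) CSkip)))
             CSkip)).

(** The final frame starts with the orthogonal basis, so the target is in the span exactly when its
    remaining coordinates vanish. *)
Definition CTestSpan : cmd :=
  CFor 8 (ISub (IVar 0) (IVar 3))
    (CIf (TScalar0 (ECell (ICst 0) (IAdd (IVar 3) (IVar 8)))) CSkip
         (CIndex 10 (ICst 1))).

(** The answer overwrites that of the earlier query. The pivots are now [t :: a], so column 0 of the
    working copy holds the [t]-coordinates; at the end the scalar cell receives the inverse of the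
    chosen one. *)
Definition COutside : cmd :=
  CSeq (COracle (IVar 1) (ICst 0) (IMul (IVar 1) (IVar 0)))
  (CSeq (CIndex 2 (ICst 0))
  (CSeq (CIndex 3 (IVar 1))
  (CSeq (CIndex 4 (IMul (ICst 2) (IVar 1)))
  (CSeq CCopyEliminate
  (CSeq (CAbs 0 EScalar)
  (CSeq (CIndex 9 (ICst 0))
  (CSeq CSelect
  (CSeq (COp OpDiv EScalar EScalar (ECell (IVar 9) (ICst 0)))
        (CSubScaled (IMul (IVar 9) (IVar 0)) EScalar))))))))).

(* Register 10 records whether the target lies outside the span of the lattice,
   register 9 the slot of the best vector; real register 0 holds |1|. *)
Definition CClosest : cmd :=
  CSeq (COracle (ISub (IVar 1) (ICst 1)) (IVar 0) (IMul (IVar 1) (IVar 0)))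
  (CSeq (COne EScalar)
  (CSeq (CIndex 2 (IVar 1))
  (CSeq (CIndex 3 (ISub (IVar 1) (ICst 1)))
  (CSeq (CIndex 4 (ISub (IMul (ICst 2) (IVar 1)) (ICst 1)))
  (CSeq CCopyEliminate
  (CSeq (CIndex 10 (ICst 0))
  (CSeq CTestSpan
  (CSeq (CIf (TIndexLe (IVar 10) (ICst 0)) (CSeq (CAbs 0 EScalar) CRound)
             COutside)
        (CIndex 1 (ICst 1)))))))))).

Section ClosestVectorProgram.
Variables (R : realType) (S : normed_space R).
Variables (norm_cost : S -> nat) (oracle : seq S -> seq S) (b : nat).
Hypothesis norm_cost_leq : forall v, norm_cost v <= b.
Hypothesis n_leq : dimS S <= b.
Hypothesis b_gt0 : 0 < b.
Hypothesis oracleP : solves (orthogonalization R) oracle.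
Variables (t : S) (a : seq S).
Hypothesis free_a : free a.
Local Notation n := (dimS S).
Local Notation m := (size a).+1.
Local Notation wp := (wp norm_cost oracle b).
Hypotheses (m_leq : 2 * m <= b) (mn_leq : 2 * m * n <= b).

Definition slots (s : state S) (vs : seq S) : Prop :=
  forall j, j < size vs -> read_vec (mem s) (j * n) = (vs`_j)%R.

Lemma free_size_leq (ws : seq S) : free ws -> size ws <= n.
Proof. by move=> /eqP <-; exact: dimvS (subvf _). Qed.

Lemma block_lt j k l d : j < k -> l < d -> j * d + l < k * d.
Proof.
move=> jk ld; apply: (@leq_trans (j.+1 * d)); rewrite ?leq_mul //.
by rewrite mulSnr ltn_add2l.
Qed.

Lemma slots_eq (s s' : state S) vs : size vs <= 2 * m -> slots s vs ->
  (forall x, x < 2 * m * n -> mem s' x = mem s x) -> slots s' vs.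
Proof.
move=> sz sl hm j jv; rewrite -sl //; apply: eq_read_vec => l ln.
by apply: hm; nia.
Qed.

Lemma slots_write (s : state S) vs ws : slots s vs ->
  slots (set_mem s (size vs * n) (encode ws)) (vs ++ ws).
Proof.
move=> sl j; rewrite size_cat nth_cat => jvw; case: ltnP => jv /=.
  rewrite -sl //; apply: eq_read_vec => l ln; apply: write_out.
  by apply/orP; left; exact: block_lt.
by rewrite -{1}(subnKC jv) mulnDl read_vec_write // ltn_subLR.
Qed.

Lemma slots_take s vs ws : slots s (vs ++ ws) -> slots s vs.
Proof.
move=> sl j jv; rewrite sl ?nth_cat ?jv // size_cat; exact: ltn_addr.
Qed.

Lemma ieval_scalar (s : state S) : idx s 0 = n -> idx s 1 = m ->
  ieval (idx s) EScalar = scalar_cell S m.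
Proof. by move=> /= -> ->; rewrite /scalar_cell; lia. Qed.

Lemma wp_sub_scaled base coef s B C (Q : state S -> Prop) :
  idx s 0 = n -> idx s 1 = m ->
  (forall f, (forall x, x != 7 -> f x = idx s x) ->
     ieval f base = B /\ ieval f coef = C) ->
  B + n <= 2 * m * n -> C <= scalar_cell S m ->
  (forall s', (forall x, x != 7 -> idx s' x = idx s x) -> rreg s' = rreg s ->
     read_vec (mem s') 0 =
       (read_vec (mem s) 0 - mem s C *: read_vec (mem s) B)%R ->
     (forall x, n <= x <= scalar_cell S m -> mem s' x = mem s x) -> Q s') ->
  wp (CSubScaled base coef) s Q.
Proof.
move=> s0 s1 he Bn CZ hQ; pose U := scalar_cell S m + 1.
have mn : n <= m * n by rewrite mulSn leq_addr.
have nU : n <= U by rewrite /U /scalar_cell; lia.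
apply/wp_seq/(@wp_parallel _ _ _ _ _ _ _ _ _ _ _ _ n
  (fun l => U + l) (fun l => B + l) (fun=> C)) => //.
- move=> f l hf fl /=; have [-> ->] := he f hf.
  by rewrite fl !hf // s0 s1 /U /scalar_cell; split; lia.
- move=> i j ij jn; move: Bn CZ; rewrite /U /scalar_cell => Bn CZ.
  by split; lia.
move=> s' hi hr hin hout.
apply: (@wp_sub_block _ _ _ _ _ n_leq _ _ _ _ 0 U) => //.
- by rewrite hi.
- move=> f hf /=; rewrite !hf // !hi // s0 s1 /U /scalar_cell; split; lia.
- by rewrite add0n nU.
move=> s2 hi2 hr2 rv hm2; apply: hQ.
- by move=> x x7; rewrite hi2 // hi.
- by rewrite hr2.
- rewrite rv; congr (_ - _)%R.
    apply: eq_read_vec => l ln; apply: hout => j jn.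
    by move: nU; rewrite /U /scalar_cell; nia.
  rewrite /read_vec scaler_sumr; apply: eq_bigr => l _.
  by rewrite hin //= scalerA mulrC.
- move=> x /andP[nx xZ]; rewrite hm2 ?nx ?orbT //; apply: hout => j jn.
  by rewrite /U; lia.
Qed.

Lemma wp_test_span s (Q : state S -> Prop) : idx s 0 = n -> idx s 1 = m ->
  idx s 3 = size a -> idx s 10 = 0 -> size a <= n ->
  (forall s', (forall x, x \notin [:: 8; 10] -> idx s' x = idx s x) ->
     mem s' = mem s ->
     (if idx s' 10 <= 0
      then forall l, size a <= l < n -> mem s (cell S m 0 l) = 0%R
      else exists2 l, size a <= l < n & mem s (cell S m 0 l) != 0%R) ->
     Q s') ->
  wp CTestSpan s Q.
Proof.
move=> s0 s1 s3 s10 an hQ.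
apply: (@wp_for _ _ _ _ _ _ _ _ _ (n - size a) (fun i s' =>
  [/\ forall x, x \notin [:: 8; 10] -> idx s' x = idx s x, mem s' = mem s &
     if idx s' 10 <= 0
      then forall l, size a <= l < size a + i -> mem s (cell S m 0 l) = 0%R
      else exists2 l, size a <= l < n & mem s (cell S m 0 l) != 0%R])).
- lia.
- by move=> i s' [hi _ _] /=; rewrite !hi // s0 s3.
- split => //=; last by rewrite s10 /=; lia.
  by move=> x; rewrite !inE negb_or => /andP[/negPf ->].
- move=> i s' i_n s8 [hi hm hx].
  have cE : ieval (idx s') (ECell (ICst 0) (IAdd (IVar 3) (IVar 8))) =
      cell S m 0 (size a + i).
    by rewrite /= s8 !hi // s0 s1 s3 /cell; lia.
  apply: wp_if; rewrite /test_eval cE hm => z0.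
    apply: wp_skip; split => //; split => //=.
      by move=> x xx; rewrite ifN ?hi //; apply: contraNneq xx => ->.
    case: ifP hx => // _ hx l lsi.
    have [->|li] := eqVneq l (size a + i); first exact/eqP.
    by apply: hx; lia.
  apply: wp_index => //=; split => //; split => //=.
    move=> x xx; have := xx; rewrite !inE negb_or.
    by move=> /andP[/negPf -> /negPf ->]; exact: hi.
  by exists (size a + i) => //; lia.
- move=> s' _ [hi hm hx]; apply: hQ => //.
  by case: ifP hx => // _ hx l ln; apply: hx; lia.
Qed.

Lemma wp_round s b' x (Q : state S -> Prop) : idx s 0 = n -> idx s 1 = m ->
  idx s 3 = size a -> size b' = size a -> slots s ((t :: a) ++ b') ->
  orthogonal b' -> lattice b' = lattice a -> t = comb x b' -> size a <= n ->
  (forall l, l < size a -> mem s (cell S m 0 l) = x l) ->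
  rreg s 0 = 1%R ->
  (forall s' v, closest a t v -> read_vec (mem s') 0 = v -> Q s') ->
  wp CRound s Q.
Proof.
move=> s0 s1 s3 sb sl ob latb tE an hx r0 hQ.
apply: (@wp_for _ _ _ _ _ _ _ _ _ (size a) (fun i s' =>
  [/\ forall y, y \notin [:: 7; 8] -> idx s' y = idx s y, rreg s' 0 = 1%R,
      forall y, n <= y <= scalar_cell S m -> mem s' y = mem s y &
      read_vec (mem s') 0 = comb (fun l =>
        if (l < i) && ~~ (absp (x l) <= 1)%R then 0%R else x l) b'])).
- lia.
- by move=> i s' [hi _ _ _] /=; rewrite hi.
- split => //=.
    by move=> y; rewrite !inE negb_or => /andP[_ /negPf ->].
  by rewrite -tE; exact: (sl 0).
- move=> i s' ia s8 [hi hr hm rv].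
  have i_n : i < n by exact: leq_trans ia an.
  have cZ : n <= cell S m 0 i <= scalar_cell S m.
    by rewrite /cell /scalar_cell; nia.
  have cE f : f 0 = n -> f 1 = m -> f 8 = i ->
      ieval f (ECell (ICst 0) (IVar 8)) = cell S m 0 i.
    by rewrite /= => -> -> ->; rewrite /cell; lia.
  have cS : ieval (idx s') (ECell (ICst 0) (IVar 8)) = cell S m 0 i.
    by apply: cE => //; rewrite hi.
  apply/wp_seq/wp_abs; rewrite cS hm // hx //.
  have upd (s2 : state S) : (forall y, y != 7 -> idx s2 y = idx s' y) ->
      forall y, y \notin [:: 7; 8] ->
      idx (set_idx s2 8 i.+1) y = idx s y.
    move=> h y; rewrite !inE negb_or => /andP[y7 y8] /=.
    by rewrite (negPf y8) h // hi // !inE negb_or y7.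
  apply: wp_if; rewrite /= hr => xi.
    apply: wp_skip; split => //; split => //=; first exact: upd.
    rewrite rv; apply: eq_comb => l _.
    by rewrite [RHS]/= [l < i.+1]ltnS [l <= i]leq_eqVlt; case: eqP => [->|//];
      rewrite xi ltnn.
  have rvi : read_vec (mem s') ((m + i) * n) = (b'`_i)%R.
    have -> : (b'`_i = ((t :: a) ++ b')`_(m + i))%R.
      by rewrite nth_cat ltnNge leq_addr /= addKn.
    rewrite -sl; last by rewrite size_cat ltn_add2l sb.
    by apply: eq_read_vec => l ln; apply: hm; rewrite /scalar_cell; nia.
  apply: (@wp_sub_scaled _ _ _ ((m + i) * n) (cell S m 0 i)).
  + by rewrite /= hi.
  + by rewrite /= hi.
  + move=> f hf; have f0 : f 0 = n by rewrite hf // hi.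
    have f1 : f 1 = m by rewrite hf // hi.
    have f8 : f 8 = i by rewrite hf.
    by rewrite (cE f) //= f0 f1 f8.
  + by nia.
  + by case/andP: cZ.
  move=> s2 hi2 hr2 rv2 hm2; rewrite hi2 //= s8; split => //; split => /=.
  + exact: upd.
  + by rewrite hr2.
  + by move=> y yn; rewrite hm2 //= hm.
  + rewrite rv2 /= rvi hm // hx // rv comb_sub_nth ?sb //; apply: eq_comb => l _.
    by rewrite [l < i.+1]ltnS [l <= i]leq_eqVlt; case: eqP => [->|//];
      rewrite ltnn /= xi subrr.
- move=> s' _ [_ _ _ rv]; apply: hQ rv.
  have := closest_round x ob; rewrite -tE /closest latb.
  rewrite (@eq_comb _ _ _ (fun l =>
    if (l < size a) && ~~ (absp (x l) <= 1)%R then 0%R else x l)) //.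
  by move=> l la; rewrite -sb la /=; case: ifP.
Qed.

Lemma wp_select s vs (phi : nat -> scalars S) (Q : state S -> Prop) :
  idx s 0 = n -> idx s 1 = m -> idx s 4 = size vs -> idx s 9 = 0 ->
  size vs = 2 * m ->
  slots s vs -> 0 < n ->
  (forall j, j < size vs -> mem s (cell S m j 0) = phi j) ->
  absp (phi 0) = 1%R -> rreg s 0 = 1%R ->
  (forall s' j, (forall x, x \notin [:: 8; 9] -> idx s' x = idx s x) ->
     mem s' = mem s -> idx s' 9 = j -> j < size vs -> (1 <= absp (phi j))%R ->
     (forall i, i < size vs -> (1 <= absp (phi i) -> norm vs`_j <= norm vs`_i)%R) ->
     Q s') ->
  wp CSelect s Q.
Proof.
move=> s0 s1 s4 s9 sz sl n0 hphi phi0 r0 hQ.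
apply: (@wp_for _ _ _ _ _ _ _ _ _ (size vs) (fun i s' => exists j,
  [/\ forall x, x \notin [:: 8; 9] -> idx s' x = idx s x,
      mem s' = mem s /\ rreg s' 0 = 1%R,
      idx s' 9 = j, j < size vs /\ (1 <= absp (phi j))%R &
      forall l, l < i -> (1 <= absp (phi l) -> norm vs`_j <= norm vs`_l)%R])).
- by rewrite sz.
- by move=> i s' [j [hi _ _ _ _]] /=; rewrite hi.
- exists 0; split => //=.
    by move=> x; rewrite !inE negb_or => /andP[/negPf ->].
  by rewrite phi0 sz.
- move=> i s' ivs s8 [j [hi [hm hr] hj [jvs phij] best]].
  have cE : ieval (idx s') (ECell (IVar 8) (ICst 0)) = cell S m i 0.
    by rewrite /= s8 !hi // s0 s1 /cell; lia.
  have upd (s2 : state S) : (forall x, x \notin [:: 8; 9] -> idx s2 x = idx s' x) ->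
      forall x, x \notin [:: 8; 9] -> idx (set_idx s2 8 i.+1) x = idx s x.
    by move=> h x xx /=; rewrite ifN ?h ?hi //; apply: contraNneq xx => ->.
  apply/wp_seq/wp_abs; rewrite cE hm hphi //.
  apply: wp_if; rewrite /= hr => phii; last first.
    apply: wp_skip; split => //; exists j; split => //=; first exact: upd.
    move=> l; rewrite ltnS leq_eqVlt => /orP[/eqP ->|/best //].
    by rewrite (negPf phii).
  apply/wp_seq/wp_norm => //; apply/wp_seq/wp_norm => //=.
  rewrite hj s8 hi // s0 hm !sl //.
  apply: wp_if; rewrite /= => le.
    apply: wp_index => /=; first by rewrite s8; lia.
    rewrite s8; split => //; exists i; split => //=.
      apply: (upd (set_idx s' 9 i)) => x xx /=; rewrite ifN //.
      by apply: contraNneq xx => ->.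
    move=> l; rewrite ltnS leq_eqVlt => /orP[/eqP -> //|/best h] /h.
    exact: le_trans.
  apply: wp_skip; split => //; exists j; split => //=; first exact: upd.
  move=> l; rewrite ltnS leq_eqVlt => /orP[/eqP -> _|/best //].
  by rewrite ltW // ltNge.
- by move=> s' _ [j [hi [hm _] hj [jvs phij] best]]; exact: (hQ s' j).
Qed.

Lemma wp_outside s (Q : state S -> Prop) : idx s 0 = n -> idx s 1 = m ->
  slots s (t :: a) -> mem s (scalar_cell S m) = 1%R -> free (t :: a) ->
  (forall s' v, closest a t v -> read_vec (mem s') 0 = v -> Q s') ->
  wp COutside s Q.
Proof.
move=> s0 s1 sl sZ fr hQ.
have mn : m <= n by exact: free_size_leq fr.
have [latc oc] := oracleP (fr : instance (orthogonalization R) (t :: a)).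
set c := oracle (t :: a) in latc oc.
have szc : size c = m by exact: lattice_basis_size latc.
have qE : read_vecs (mem s) (ieval (idx s) (IVar 1)) (ieval (idx s) (ICst 0)) =
    t :: a by rewrite /= s1; exact: eq_read_vecs.
apply/wp_seq/wp_oracle; rewrite ?qE -/c //.
- by rewrite /= s1; lia.
- by rewrite szc; lia.
set vs := (t :: a) ++ c; set s' := set_mem _ _ _.
have szvs : size vs = 2 * m by rewrite size_cat szc mul2n addnn.
have sl' : slots s' vs by rewrite /s' /= s0 s1; exact: slots_write.
have hi' x : idx s' x = idx s x by [].
have sZ' : mem s' (scalar_cell S m) = 1%R.
  rewrite /s' /= s0 s1 write_out // size_encode szc /scalar_cell.
  by apply/orP; right; nia.
clearbody s'.
apply/wp_seq/wp_index; rewrite //=.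
apply/wp_seq/wp_index; rewrite /= ?hi' s1; first by lia.
apply/wp_seq/wp_index; rewrite /= ?hi' s1 //.
set s2 := set_idx (set_idx (set_idx s' 2 0) 3 m) 4 (2 * m).
have uE j : j < size vs -> read_vec (mem s2) (j * n) = (vs`_j)%R by exact: sl'.
apply/wp_seq/(@wp_copy_eliminate _ _ _ _ _ m 0 m (2 * m)) => //.
- lia.
- by split; rewrite /= ?hi'.
- move=> z z0; apply: (free_indep fr); rewrite -[RHS]z0; apply: eq_bigr => i _.
  rewrite add0n uE ?szvs; last by have := ltn_ord i; rewrite /=; lia.
  by rewrite nth_cat ltn_ord.
move=> s3 [hi3 hm3] [f [ind rep fx]].
have s30 : idx s3 0 = n by rewrite hi3 //= hi'.
have s31 : idx s3 1 = m by rewrite hi3 //= hi'.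
have s34 : idx s3 4 = 2 * m by rewrite hi3.
have sl3 : slots s3 vs.
  by apply: (slots_eq (s := s')) => //; rewrite ?szvs // => x xl;
    rewrite hm3 //= xl.
have sZ3 : mem s3 (scalar_cell S m) = 1%R by rewrite hm3 //= leqnn orbT.
clear hi3 hm3.
have fE i : i < size (t :: a) -> f i = ((t :: a)`_i)%R.
  move=> im; rewrite fx // add0n uE ?szvs; last by move: im => /=; lia.
  by rewrite nth_cat im.
pose phi j := mem s3 (cell S m j 0).
have cvs i : (c`_i = vs`_(m + i))%R.
  by rewrite nth_cat ltnNge leq_addr /= addKn.
have hphi j : j < size vs ->
    (absp (phi j) <= 1)%R /\ lattice a (vs`_j - phi j *: t)%R.
  move=> jm.
  apply: (lattice_cons_coord (X := fun l => mem s3 (cell S m j l)) fr mn ind fE).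
    by rewrite -uE // rep // -szvs.
  have := mem_nth 0%R jm; rewrite mem_cat => /orP[|]; first exact: lattice_mem.
  by move=> vc; rewrite -(latc.2); exact: lattice_mem.
have n0 : 0 < n by exact: leq_trans mn.
(* The target has [t]-coordinate 1, which makes slot 0 a legitimate initial candidate for the
   selection. *)
have phi0 : phi 0 = 1%R.
  have : f 0 = lin n (fun l => mem s3 (cell S m 0 l)) f by rewrite fx // rep.
  rewrite (_ : f 0 = lin n (fun l => (l == 0)%:R%R) f).
    by rewrite /phi => /(indep_inj ind)/(_ 0 n0) <-.
  rewrite /lin (bigD1 (Ordinal n0)) //= scale1r big1 ?addr0 // => i.
  by rewrite -val_eqE /= => /negPf ->; rewrite scale0r.
apply/wp_seq/wp_abs; rewrite ieval_scalar // sZ3 absp1.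
apply/wp_seq/wp_index => //.
apply/wp_seq/(@wp_select _ vs phi) => //=; rewrite ?s34 ?szvs //.
- by rewrite phi0 absp1.
move=> s4 j hi4 hm4 s49 jm phij best.
have phij1 : absp (phi j) = 1%R.
  apply/eqP; rewrite eq_le phij andbT.
  by have [] := hphi j jm.
have s40 : idx s4 0 = n by rewrite hi4.
have s41 : idx s4 1 = m by rewrite hi4.
have ZE := ieval_scalar s40 s41.
have cE : ieval (idx s4) (ECell (IVar 9) (ICst 0)) = cell S m j 0.
  by rewrite /= s40 s41 s49 /cell; lia.
apply/wp_seq/wp_op; rewrite ZE cE /= hm4 /= sZ3 -/(phi j) div1r.
apply: (@wp_sub_scaled _ _ _ (j * n) (scalar_cell S m)) => //.
- move=> f' hf' /=; rewrite !hf' //= s40 s41 s49 /scalar_cell; split; lia.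
- have jm2 : j < 2 * m by rewrite -szvs.
  by rewrite -mulSnr leq_mul2r jm2 orbT.
move=> s5 _ _ rv _; apply: (hQ s5 (t - (phi j)^-1 *: vs`_j)%R).
  apply: (closest_unit (phi := fun i => phi (m + i)) fr oc latc.2) => //.
  - by move=> i ic; rewrite cvs; apply: hphi; rewrite size_cat ltn_add2l.
  - by have [] := hphi j jm.
  - move=> i ic hi; rewrite cvs; apply: best hi.
    have ivs : m + i < size vs by rewrite size_cat ltn_add2l.
    exact: ivs.
rewrite rv /= write1E eqxx; congr (_ - _ *: _)%R.
  rewrite -[RHS](sl3 0); last by rewrite szvs.
  apply: eq_read_vec => l ln; rewrite /= hm4 write1E ifN //.
  by rewrite /scalar_cell; nia.
rewrite -[RHS](sl3 j jm); apply: eq_read_vec => l ln; rewrite /= hm4 write1E ifN //.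
have : j * n + l < 2 * m * n by apply: block_lt => //; rewrite -szvs.
by rewrite /scalar_cell; lia.
Qed.

Lemma wp_closest s : idx s 0 = n -> idx s 1 = m -> slots s (t :: a) ->
  wp CClosest s (fun s' => exists v, closest a t v /\ output s' = [:: v]).
Proof.
move=> s0 s1 sl.
have an : size a <= n by exact: free_size_leq.
have [latb ob] := oracleP (free_a : instance (orthogonalization R) a).
set b' := oracle a in latb ob.
have szb : size b' = size a by exact: lattice_basis_size latb.
have qE : read_vecs (mem s) (ieval (idx s) (ISub (IVar 1) (ICst 1)))
    (ieval (idx s) (IVar 0)) = a.
  rewrite /= s0 s1 subn1 /=; apply: eq_read_vecs => // j ja.
  by rewrite -mulSn (sl j.+1).
apply/wp_seq/wp_oracle; rewrite ?qE -/b' //.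
- by rewrite /= s1; lia.
- by rewrite szb; lia.
set vs := (t :: a) ++ b'; set s' := set_mem _ _ _.
(* One target and two bases of [m - 1] vectors each. *)
have szvs : size vs = (2 * m).-1 by rewrite size_cat szb /=; lia.
have sl' : slots s' vs by rewrite /s' /= s0 s1; exact: slots_write.
have hi' x : idx s' x = idx s x by [].
clearbody s'.
apply/wp_seq/wp_one.
rewrite ieval_scalar ?hi' //.
set s1' := set_mem _ _ _.
have sZ1 : mem s1' (scalar_cell S m) = 1%R by rewrite /= write1E eqxx.
have sl1 : slots s1' vs.
  apply: slots_eq sl' _; first by rewrite szvs; lia.
  by move=> x xl; rewrite /= write1E ifN // /scalar_cell; lia.
have hi1 x : idx s1' x = idx s x by exact: hi'.
clearbody s1'.
apply/wp_seq/wp_index; rewrite /= ?hi1 s1; first by lia.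
apply/wp_seq/wp_index; rewrite /= ?hi1 s1 subn1; first by lia.
apply/wp_seq/wp_index; rewrite /= ?hi1 s1 subn1; first by lia.
set s2 := set_idx (set_idx (set_idx s1' 2 m) 3 (size a)) 4 (2 * m).-1.
have uE j : j < size vs -> read_vec (mem s2) (j * n) = (vs`_j)%R by exact: sl1.
apply/wp_seq/(@wp_copy_eliminate _ _ _ _ _ m m (size a) (2 * m).-1) => //.
- lia.
- nia.
- lia.
- by split; rewrite /= ?hi1.
- move=> z z0; rewrite -szb; apply: (free_indep latb.1).
  rewrite szb -[RHS]z0; apply: eq_bigr => i _.
  rewrite uE ?szvs; last by have := ltn_ord i; lia.
  by rewrite nth_cat ltnNge leq_addr /= addKn.
move=> s3 [hi3 hm3] [f [ind rep fx]].
have s30 : idx s3 0 = n by rewrite hi3 //= hi1.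
have s31 : idx s3 1 = m by rewrite hi3 //= hi1.
have s33 : idx s3 3 = size a by rewrite hi3.
have sl3 : slots s3 vs.
  by apply: (slots_eq (s := s1')) => //; rewrite ?szvs; [lia|] => x xl;
    rewrite hm3 //= xl.
have sZ3 : mem s3 (scalar_cell S m) = 1%R by rewrite hm3 //= leqnn orbT.
clear hi3 hm3.
have fE i : i < size a -> f i = (b'`_i)%R.
  move=> im; rewrite fx // uE ?szvs; last by lia.
  by rewrite nth_cat ltnNge leq_addr /= addKn.
pose X l := mem s3 (cell S m 0 l).
have tX : t = lin n X f by rewrite -rep ?uE ?szvs //; lia.
have combf z : comb z b' = lin (size a) z f.
  by rewrite combE szb; apply: eq_bigr => i _; rewrite fE.
have final s6 v : closest a t v -> read_vec (mem s6) 0 = v ->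
    wp (CIndex 1 (ICst 1)) s6
      (fun s7 => exists v, closest a t v /\ output s7 = [:: v]).
  move=> cv rv; apply: wp_index => //; exists v; split => //.
  by rewrite /output /read_vecs /= mul0n add0n rv.
apply/wp_seq/wp_index => //.
apply/wp_seq/wp_test_span => //= s4 hi4 hm4 span.
have s40 : idx s4 0 = n by rewrite hi4.
have s41 : idx s4 1 = m by rewrite hi4.
have sl4 : slots s4 vs by move=> j jv; rewrite hm4 sl3.
have sZ4 : mem s4 (scalar_cell S m) = 1%R by rewrite hm4.
apply/wp_seq/wp_if => /= h10; last first.
  rewrite (negPf h10) in span; have [l /andP[al ln] Xl] := span.
  apply: wp_outside => //; first exact: slots_take sl4.
  rewrite free_cons free_a andbT; apply/negP.
  rewrite -(eq_lattice_span latb.2) => /mem_spanP[z tz]; case/eqP: Xl.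
  (* If [t] were in the span, uniqueness of coordinates would force the nonzero entry that was found
     to be 0. *)
  have : lin n X f = lin n (fun i => if i < size a then z i else 0%R) f.
    rewrite -tX tz combf [RHS](lin_short (m := size a)) //.
      by apply: eq_lin => i ->.
    by move=> i /andP[ai _]; rewrite ltnNge ai.
  by move=> /(indep_inj ind)/(_ l ln); rewrite ltnNge al.
rewrite h10 in span.
apply/wp_seq/wp_abs; rewrite ieval_scalar // sZ4 absp1.
apply: (@wp_round _ b' X) => //=.
- by rewrite hi4.
- exact: latb.2.
- by rewrite combf tX (lin_short (m := size a)).
- by move=> l la; rewrite hm4.
Qed.

End ClosestVectorProgram.

(** * The polynomial-time reductions *)

(** With [k] the dimension plus the number of input vectors, [Q] covers the norm costs,
    [2 * (k * k)] the cells of twice the input, [2 * k] the vector counts, and 1 keeps the bound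
    positive. *)
Definition size_bound (Q : {poly nat}) (k : nat) : nat :=
  Q.[k]%R + (2 * (k * k) + 2 * k + 1).

Lemma poly_bounded_size_bound Q : poly_bounded (size_bound Q).
Proof.
apply: poly_boundedD; first by exists Q.
have idM c := poly_boundedM (poly_bounded_cst c) poly_bounded_id.
apply/poly_boundedD/poly_bounded_cst/poly_boundedD/idM.
exact/poly_boundedM/(poly_boundedM poly_bounded_id poly_bounded_id)/poly_bounded_cst.
Qed.

Lemma init_bounded (R : realType) (S : normed_space R) (vs : seq S) b :
  dimS S <= b -> size vs <= b -> bounded b (init vs).
Proof. by move=> nb vb [|[|x]] //=; rewrite nth_nil. Qed.

(** The bound [b] is arbitrary in the hypothesis, so program correctness can be proved without any
    reference to polynomials; here [b] becomes a polynomial in the input size. *)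
Lemma wp_poly_time (R : realType) (F : normed_space R -> Prop)
    (norm_cost : forall S : normed_space R, S -> nat) (A B : problem R)
    (c : cmd) : efficient_norms F norm_cost ->
  (forall (S : normed_space R) (oracle : seq S -> seq S) (x : seq S) b,
     solves B oracle -> instance A x -> (forall v : S, norm_cost S v <= b) ->
     0 < b -> dimS S <= b -> 2 * size x <= b -> 2 * size x * dimS S <= b ->
     wp (@norm_cost S) oracle b c (init x) (fun s => solution A x (output s))) ->
  poly_time_given_oracle F norm_cost A B.
Proof.
move=> [Q hQ] h; have [P hP] := poly_bounded_time (poly_bounded_size_bound Q) c.
exists c, P => S FS oracle oracleP x ix.
have [k kE] : exists k, k = dimS S + size x by eexists.
pose b := size_bound Q k.
have kb : 2 * (k * k) + 2 * k + 1 <= b by exact: leq_addl.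
have nk : dimS S <= k by rewrite kE leq_addr.
have xk : size x <= k by rewrite kE leq_addl.
have xnk : size x * dimS S <= k * k by exact: leq_mul.
have [||||||t [s [e l _ sol]]] :=
  h S oracle x b oracleP ix _ _ _ _ _ _; try lia.
- move=> v; apply: leq_trans (hQ S FS v) _.
  exact: leq_trans (leq_horner Q nk) (leq_addr _ _).
- by apply: init_bounded; lia.
- exists t, s; split => //; apply: leq_trans l (leq_trans (hP k) _).
  by rewrite kE.
Qed.

Theorem theorem7p2 (R : realType) (F : normed_space R -> Prop)
    (norm_cost : forall S : normed_space R, S -> nat)
    (hF : efficient_norms F norm_cost) :
  poly_equivalent F norm_cost (orthogonalization R) (closest_vector R).
Proof.
split.
  apply: (wp_poly_time (c := COrthogonalize)) => //.
  move=> S oracle a b oracleP fa costb b0 nb ab _.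
  have ab' : size a <= b by lia.
  apply: (wp_mono _ (wp_orthogonalize costb nb b0 oracleP fa ab' (init_stores a))).
  move=> s [b' [st sz lat orth]]; rewrite (output_stores st).
  by split => //; split => //; apply: free_size_span fa => //; exact: eq_lattice_span.
apply: (wp_poly_time (c := CClosest)) => //.
move=> S oracle x b oracleP [t [a [-> fa]]] costb b0 nb xb xnb.
apply: (wp_mono _ (wp_closest costb nb b0 oracleP fa xb xnb
  (t := t) (s := init (t :: a)) erefl erefl _)).
  by move=> s [v [[lv vmin] ->]]; exists t, a, v.
by move=> j; exact: read_vec_init.
Qed.
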